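(* Let $\Omega \subset \mathbb{R}^N$ be an open, bounded, convex set. Let $B_r\subset\mathbb{R}^N$ be an open ball of radius $r>0$ such that $|\Omega|=|B_r|$. Then $$\mu_1(\Omega) \leq \mu_1(B_r),$$ and equality holds if and only if $\Omega = B_r$ up to translation (that is, $\Omega$ is an open ball of radius $r$).
   Context: For a symmetric $N\times N$ matrix $X$, $\lambda_1(X)\le \dots\le \lambda_N(X)$ denote its ordered eigenvalues, so $\lambda_N(X)$ is the largest one. For an open, bounded, nonempty set $\Omega\subset\mathbb{R}^N$, the principal eigenvalue of the operator $-\lambda_N(D^2 u)$ with Dirichlet boundary conditions is defined by $$\mu_1(\Omega) := \sup \{ \mu \in \mathbb{R} : \exists\, \varphi \in LSC(\Omega),\ \varphi > 0 \text{ in }\Omega, \text{ such that } -\lambda_N(D^2 \varphi) \geq \mu \varphi \text{ in } \Omega\},$$ where $LSC(\Omega)$ is the set of lower semicontinuous real functions on $\Omega$ and the inequality is understood in the viscosity sense: for every $x_0\in\Omega$ and every $C^2$ function $\psi$ defined near $x_0$ such that $\varphi-\psi$ has a local minimum at $x_0$ with $\varphi(x_0)=\psi(x_0)$, one has $-\lambda_N(D^2\psi(x_0))\ge \mu\,\varphi(x_0)$. $|\Omega|$ denotes the $N$-dimensional Lebesgue measure of $\Omega$. *)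

(* Defs.v *)
From HB Require Import structures.
From mathcomp Require Import all_boot all_order all_algebra.
From mathcomp Require Import all_classical all_reals all_analysis.

Set Implicit Arguments.
Unset Strict Implicit.
Unset Printing Implicit Defensive.

Import Order.TTheory GRing.Theory Num.Theory.
Import numFieldNormedType.Exports.

Local Open Scope classical_set_scope.
Local Open Scope ring_scope.

(* The normed-space structure of ['rV[R]_N] carries the sup norm. It gives the
   usual topology and bounded sets of R^N, but its [ball]s are cubes, hence the
   separate Euclidean balls below. *)

Definition enorm (R : realType) (N : nat) (x : 'rV[R]_N) : R :=
  Num.sqrt (\sum_(i < N) x 0 i ^+ 2).

Definition eball (R : realType) (N : nat) (c : 'rV[R]_N) (r : R) :
  set 'rV[R]_N := [set x | enorm (x - c) < r].

Record sigma_finite_space (R : realType) := SigmaFiniteSpace {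
  space_display : measure_display;
  space_carrier : measurableType space_display;
  space_measure : {sigma_finite_measure set space_carrier -> \bar R}
}.

(* The library's sigma-finiteness instance for products of measures is shadowed
   by the one for subprobabilities, so it is redeclared on a named constant. *)
Definition prod_measure d1 d2 (T1 : measurableType d1) (T2 : measurableType d2)
    (R : realType) (m1 : {sigma_finite_measure set T1 -> \bar R})
    (m2 : {sigma_finite_measure set T2 -> \bar R}) :
  set (T1 * T2) -> \bar R := (m1 \x m2)%E.

Section prod_measure_sigma_finite.
Context d1 d2 (T1 : measurableType d1) (T2 : measurableType d2) (R : realType).
Variables (m1 : {sigma_finite_measure set T1 -> \bar R})
          (m2 : {sigma_finite_measure set T2 -> \bar R}).

HB.instance Definition _ := Measure.on (prod_measure m1 m2).

Let prod_measure_sigma_finite : sigma_finite setT (prod_measure m1 m2).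
Proof.
have /sigma_finiteP[F [TF ndF Foo]] := sigma_finiteT m1.
have /sigma_finiteP[G [TG ndG Goo]] := sigma_finiteT m2.
exists (fun n => F n `*` G n).
  rewrite -setXTT TF TG predeqE => -[x y]; split.
    move=> [/= [n _ Fnx] [k _ Gky]]; exists (maxn n k) => //; split.
    - by move: x Fnx; exact/subsetPset/ndF/leq_maxl.
    - by move: y Gky; exact/subsetPset/ndG/leq_maxr.
  by move=> [n _ []/= ? ?]; split; exists n.
move=> k; have [? ?] := Foo k; have [? ?] := Goo k.
split; first exact: measurableX.
by rewrite /prod_measure product_measure1E// lte_mul_pinfty// ge0_fin_numE.
Qed.

HB.instance Definition _ := Measure_isSigmaFinite.Build _ _ _
  (prod_measure m1 m2) prod_measure_sigma_finite.

End prod_measure_sigma_finite.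

Definition prod_space (R : realType) (S1 S2 : sigma_finite_space R) :
    sigma_finite_space R :=
  @SigmaFiniteSpace R _ (space_carrier S1 * space_carrier S2)%type
    (prod_measure (space_measure S1) (space_measure S2)).

Definition lebesgue_line (R : realType) : sigma_finite_space R :=
  @SigmaFiniteSpace R _ (measurableTypeR R) lebesgue_measure.

Definition point_space (R : realType) : sigma_finite_space R :=
  @SigmaFiniteSpace R _ unit (dirac tt).

(* The product R * (R * (... * unit)) of N copies of the real line, with the
   product sigma-algebra and the product of the one-dimensional Lebesgue
   measures. *)
Definition lebesgue_space (R : realType) (N : nat) : sigma_finite_space R :=
  iter N (prod_space (lebesgue_line R)) (point_space R).

Fixpoint lebesgue_coord (R : realType) (N : nat) :
    space_carrier (lebesgue_space R N) -> 'rV[R]_N :=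
  match N with
  | 0 => fun _ => 0
  | N'.+1 => fun p =>
      row_mx (const_mx p.1 : 'rV[R]_1) (lebesgue_coord p.2)
  end.

(* The N-dimensional Lebesgue measure |A|, meaningful for Borel sets A. *)
Definition volume (R : realType) (N : nat) (A : set 'rV[R]_N) : \bar R :=
  space_measure (lebesgue_space R N) (@lebesgue_coord R N @^-1` A).

(* The set of eigenvalues of a symmetric matrix of size N > 0 is finite and
   nonempty, so this supremum is a maximum. *)
Definition lambda_max (R : realType) (N : nat) (X : 'M[R]_N) : R :=
  sup [set a | eigenvalue X a].

Definition partial (R : realType) (N : nat) (i : 'I_N) (f : 'rV[R]_N -> R) :
  'rV[R]_N -> R := fun x => 'D_(delta_mx 0 i) f x.

Definition hessian (R : realType) (N : nat) (f : 'rV[R]_N -> R)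
    (x : 'rV[R]_N) : 'M[R]_N :=
  \matrix_(i, j) partial i (partial j f) x.

(* Functions are total, but only the values of f near x0 matter. *)
Definition C2_near (R : realType) (N : nat) (f : 'rV[R]_N -> R)
    (x0 : 'rV[R]_N) : Prop :=
  \forall x \near x0,
    [/\ {for x, continuous f},
        (forall i, derivable f x (delta_mx 0 i) /\
                   {for x, continuous (partial i f)}) &
        (forall i j, derivable (partial j f) x (delta_mx 0 i) /\
                     {for x, continuous (partial i (partial j f))})].

(* phi is lower semicontinuous on Omega, whatever its values outside. *)
Definition LSC (R : realType) (N : nat) (Omega : set 'rV[R]_N)
    (phi : 'rV[R]_N -> R) : Prop :=
  lower_semicontinuous (fun x : subspace Omega => (phi x)%:E).

(* - lambda_N(D^2 phi) >= mu * phi in Omega, in the viscosity sense *)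
Definition viscosity_supersol (R : realType) (N : nat) (Omega : set 'rV[R]_N)
    (mu : R) (phi : 'rV[R]_N -> R) : Prop :=
  forall (x0 : 'rV[R]_N) (psi : 'rV[R]_N -> R),
    Omega x0 -> C2_near psi x0 ->
    (\forall x \near x0, Omega x -> phi x0 - psi x0 <= phi x - psi x) ->
    phi x0 = psi x0 ->
    mu * phi x0 <= - lambda_max (hessian psi x0).

Definition mu1 (R : realType) (N : nat) (Omega : set 'rV[R]_N) : \bar R :=
  ereal_sup [set mu%:E | mu in [set mu : R |
    exists phi : 'rV[R]_N -> R,
      [/\ LSC Omega phi,
          (forall x, Omega x -> 0 < phi x) &
          viscosity_supersol Omega mu phi]]].

(* Main.v *)
Require Import Defs.
From mathcomp Require Import all_boot all_order all_algebra.
From mathcomp Require Import all_classical all_reals all_analysis.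
From mathcomp Require Import measurable_realfun.
From mathcomp Require Import ring lra.
Import Order.TTheory GRing.Theory Num.Theory.
Import numFieldNormedType.Exports.
Local Open Scope classical_set_scope.
Local Open Scope ring_scope.

(** The inequality [- lambda_N (D^2 phi) >= mu phi] says that the second
    derivative of [phi] in every direction is at most [- mu phi]. Restricting to
    a segment of length [l] contained in [Omega] therefore gives
    [mu <= (pi / l)^2], the first eigenvalue of the segment
    ([mu1_segment_le]): the principal eigenvalue is small as soon as the domain
    has a large diameter. In a ball of radius [r] the function
    [cos (pi |x - c| / 2r)] shows that diameters are the worst segments, so that
    [mu1 = (pi / 2r)^2] ([mu1_ball_ge], [mu1_ball]).

    Thus the theorem follows from the isodiametric inequality and its case of
    equality: an open convex set with the volume of a ball of radius [r] either
    contains two points at distance larger than [2r], and then its principal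
    eigenvalue is smaller than that of the ball, or it is itself a ball of
    radius [r] ([isodiametric_rigidity]).

    For the latter, let [Omega] have diameter at most [2r], and let it be
    symmetrized successively along the coordinate axes, towards the centre [c]
    of the given ball. Steiner symmetrization preserves the volume
    ([volume_steiner]), openness, convexity and the diameter bound, and the
    final set is symmetric with respect to [c], hence contained in the ball of
    radius [r] centred at [c], hence equal to it because of its volume. It
    remains to undo the symmetrizations ([steiner_eq_ball]): if the
    symmetrization of [A] along one axis is a ball, then the diameter bound
    for pairs of points over opposite points of the base shows that the
    midpoints of opposite sections agree, and over nearly opposite points that
    the midpoint varies at most quadratically in the base point. So it is
    constant and [A] is a translate of the ball.

    Passing from the viscosity inequality to second derivatives in one
    direction uses that the Hessian of a twice continuously differentiable
    function is symmetric ([C2_hessian_sym]), that its quadratic form is the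
    second derivative along lines ([C2_derive2_line]), and that [lambda_max] is
    the maximum of the Rayleigh quotient ([rayleigh_max]). *)

(** * Euclidean geometry of row vectors *)

Lemma continuous_sum_ord {R : realType} {T : topologicalType} n (x : T)
    (f : 'I_n -> T -> R) :
  (forall i, {for x, continuous (f i)}) ->
  {for x, continuous (fun y => \sum_(i < n) f i y)}.
Proof.
by move=> cf; apply: cvg_big => [|i _]; [exact: add_continuous|exact: cf].
Qed.

Section Dot.
Context {R : realType} {N : nat}.
Implicit Types u v w : 'rV[R]_N.

Definition dot u v : R := \sum_(i < N) u 0 i * v 0 i.

Lemma dotC u v : dot u v = dot v u.
Proof. by apply: eq_bigr => i _; rewrite mulrC. Qed.

Lemma dotDl u v w : dot (u + v) w = dot u w + dot v w.
Proof. by rewrite -big_split; apply: eq_bigr => i _; rewrite mxE mulrDl. Qed.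

Lemma dotDr u v w : dot w (u + v) = dot w u + dot w v.
Proof. by rewrite dotC dotDl !(dotC w). Qed.

Lemma dotZl a u v : dot (a *: u) v = a * dot u v.
Proof. by rewrite mulr_sumr; apply: eq_bigr => i _; rewrite mxE mulrA. Qed.

Lemma dotZr a u v : dot u (a *: v) = a * dot u v.
Proof. by rewrite dotC dotZl dotC. Qed.

Lemma dotNl u v : dot (- u) v = - dot u v.
Proof. by rewrite -scaleN1r dotZl mulN1r. Qed.

Lemma dotNr u v : dot u (- v) = - dot u v.
Proof. by rewrite dotC dotNl dotC. Qed.

Definition dotE := (dotDl, dotDr, dotNl, dotNr, dotZl, dotZr).

Lemma dot_ge0 u : 0 <= dot u u.
Proof. by apply: sumr_ge0 => i _; rewrite -expr2 sqr_ge0. Qed.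

Lemma dot_eq0 u : (dot u u == 0) = (u == 0).
Proof.
apply/idP/eqP => [|->]; last by rewrite /dot big1 // => i _; rewrite mxE mul0r.
rewrite psumr_eq0 => [/allP u0|i _]; last by rewrite -expr2 sqr_ge0.
apply/rowP => i; rewrite mxE; apply/eqP.
by have := u0 i (mem_index_enum i); rewrite /= mulf_eq0 orbb.
Qed.

Lemma dot_gt0 u : u != 0 -> 0 < dot u u.
Proof. by move=> u0; rewrite lt_def dot_eq0 u0 dot_ge0. Qed.

Lemma dot_delta u i : dot u (delta_mx 0 i) = u 0 i.
Proof.
rewrite /dot (bigD1 i) //= big1 ?addr0 ?mxE ?eqxx ?mulr1 // => j ji.
by rewrite mxE eqxx (negPf ji) mulr0.
Qed.

Lemma enormE u : enorm u = Num.sqrt (dot u u).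
Proof. by rewrite /enorm; congr Num.sqrt; apply: eq_bigr => i _; rewrite expr2. Qed.

Lemma enorm_ge0 u : 0 <= enorm u.
Proof. by rewrite enormE sqrtr_ge0. Qed.

Lemma enorm_sqr u : enorm u ^+ 2 = dot u u.
Proof. by rewrite enormE sqr_sqrtr ?dot_ge0. Qed.

Lemma enorm_lt u r : 0 < r -> (enorm u < r) = (dot u u < r ^+ 2).
Proof.
by move=> r0; rewrite -enorm_sqr ltr_pXn2r // nnegrE ?enorm_ge0 ?ltW.
Qed.

Lemma dot_continuous : continuous (fun u => dot u u).
Proof.
move=> u; apply: continuous_sum_ord => i.
apply: (@cvgM _ _ (nbhs u) _ (fun v => v 0 i) (fun v => v 0 i)); exact: coord_continuous.
Qed.

Lemma dotr_continuous w : continuous (fun u => dot u w).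
Proof.
move=> u; apply: continuous_sum_ord => i.
apply: (@cvgMr_tmp _ _ (nbhs u) _ (fun v => v 0 i)); exact: coord_continuous.
Qed.

(** Cauchy-Schwarz, from the nonnegativity of the squared norm of
    [dot v v *: u - dot u v *: v]. *)
Lemma dot_CS u v : dot u v ^+ 2 <= dot u u * dot v v.
Proof.
have [->|v0] := eqVneq v 0.
  by rewrite -(scale0r (0 : 'rV[R]_N)) !dotE; lra.
have := dot_ge0 (dot v v *: u - dot u v *: v); have := dot_gt0 v v0.
rewrite !dotE (dotC v u); set a := dot u u; set b := dot u v; set c := dot v v.
move=> c0 h; have : 0 <= c * (a * c - b ^+ 2) by lra.
by rewrite pmulr_rge0 // subr_ge0.
Qed.

Lemma coord_le_enorm u i : `|u 0 i| <= enorm u.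
Proof.
rewrite enormE -sqrtr_sqr ler_wsqrtr // /dot (bigD1 i) //= -expr2 lerDl.
by apply: sumr_ge0 => j _; rewrite -expr2 sqr_ge0.
Qed.

Lemma norm_le_enorm u : `|u| <= enorm u.
Proof.
rewrite [leLHS]/Num.norm /= mx_normrE; apply/bigmax_leP; split=> [|[j i] _ /=].
  exact: enorm_ge0.
by rewrite (ord1 j) coord_le_enorm.
Qed.

End Dot.

(** * The largest eigenvalue of a symmetric matrix *)

Section LambdaMax.
Context {R : realType} {N : nat}.
Implicit Types (H : 'M[R]_N) (u v w : 'rV[R]_N).

Definition qform H u v : R := dot (u *m H) v.

Lemma qformE H u v : qform H u v = \sum_i \sum_j u 0 i * v 0 j * H i j.
Proof.
rewrite /qform /dot exchange_big; apply: eq_bigr => j _.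
rewrite mxE mulr_suml; apply: eq_bigr => i _; by rewrite mulrAC.
Qed.

Lemma qformC H u v : H^T = H -> qform H u v = qform H v u.
Proof.
move=> sH; rewrite !qformE exchange_big; apply: eq_bigr => i _.
by apply: eq_bigr => j _; rewrite -{1}sH mxE (mulrC (u _ _)).
Qed.

(** A maximizer [v] of the Rayleigh quotient on the unit sphere is an
    eigenvector: the quadratic polynomial [t |-> l |v + t w|^2 - H(v + t w)] is
    nonnegative and vanishes at 0, so its linear coefficient vanishes, for
    every direction [w]. *)
Lemma rayleigh_max H : (0 < N)%N -> H^T = H ->
  exists2 l, eigenvalue H l & forall u, qform H u u <= l * dot u u.
Proof.
move=> N0 sH; pose S := [set v : 'rV[R]_N | dot v v = 1].
have S0 : S !=set0.
  exists (delta_mx 0 (Ordinal N0)); rewrite /S /= dot_delta mxE !eqxx //.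
have cS : compact S.
  apply: bounded_closed_compact.
    exists 1; split=> // M M1 v /= Sv; apply: le_trans (ltW M1).
    by apply: le_trans (norm_le_enorm v) _; rewrite enormE Sv sqrtr1.
  have -> : S = (fun v => dot v v) @^-1` [set 1] by [].
  by apply: closed_comp => [v _|]; [exact: dot_continuous|exact: closed_eq].
have cq : continuous (fun v => qform H v v).
  move=> v; rewrite /qform /dot.
  apply: continuous_sum_ord => i; 
  apply: (@cvgM _ _ (nbhs v) _ (fun w => (w *m H) 0 i) (fun w => w 0 i));
    last exact: coord_continuous.
  rewrite /continuous_at mxE; under eq_fun do rewrite mxE.
  apply: continuous_sum_ord => j.
  by apply: (@cvgMr_tmp _ _ (nbhs v) _ (fun w => w 0 j)); exact: coord_continuous.
have [v] := EVT_max_rV S0 cS (continuous_subspaceT cq).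
rewrite inE => Sv vmax; pose l := qform H v v.
have lmax u : qform H u u <= l * dot u u.
  have [->|u0] := eqVneq u 0.
    by rewrite /qform mul0mx -(scale0r (0 : 'rV[R]_N)) !dotE; lra.
  have d0 := dot_gt0 u u0; pose a := (enorm u)^-1.
  have e0 : enorm u != 0.
    by rewrite -sqrf_eq0 enorm_sqr gt_eqF.
  have /vmax : a *: u \in S.
    by rewrite inE /S /= !dotE -enorm_sqr /a; field.
  rewrite /qform -scalemxAl !dotE mulrA -expr2 exprVn enorm_sqr.
  by rewrite -ler_pdivrMr // mulrC.
exists l => //; apply/eigenvalueP; exists v; last first.
  by rewrite -dot_eq0 Sv oner_eq0.
suff key w : dot (v *m H - l *: v) w = 0.
  by apply/eqP; rewrite -subr_eq0 -dot_eq0 key.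
apply/eqP; have quad t : 0 <= (- 2 * t) * dot (v *m H - l *: v) w
    + t ^+ 2 * (l * dot w w - qform H w w).
  have := lmax (v + t *: w); rewrite -subr_ge0.
  have sq : qform H w v = qform H v w by apply: qformC.
  rewrite /qform mulmxDl -scalemxAl !dotE -!/(qform _ _ _) sq (dotC w v) Sv -/l.
  by rewrite (_ : qform H v w = dot (v *m H) w) //; lra.
set b := dot _ w in quad *; set c := l * dot w w - _ in quad.
have c0 : 0 <= c by rewrite subr_ge0.
apply/negPn/negP => b0.
have := quad (b / (c + 1)).
have c1 : c + 1 != 0 by rewrite gt_eqF // ltr_wpDl.
have -> : - 2 * (b / (c + 1)) * b + (b / (c + 1)) ^+ 2 * c =
   - ((b / (c + 1)) ^+ 2 * (c + 2)) by field.
rewrite oppr_ge0 leNgt => /negP; apply; apply: mulr_gt0; last lra.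
by rewrite lt_def sqr_ge0 andbT sqrf_eq0 mulf_neq0 // invr_eq0.
Qed.

Lemma lambda_max_rayleigh H : (0 < N)%N -> H^T = H ->
  eigenvalue H (lambda_max H) /\
  forall u, qform H u u <= lambda_max H * dot u u.
Proof.
move=> N0 sH; have [l Hl lmax] := rayleigh_max H N0 sH.
suff -> : lambda_max H = l by [].
apply/eqP; rewrite eq_le; apply/andP; split; last first.
  apply: ub_le_sup => //; exists l => a /eigenvalueP[v va v0].
  have := lmax v; rewrite /qform va dotZl ler_pM2r //; exact: dot_gt0.
apply: ge_sup; first by exists l.
move=> a /eigenvalueP[v va v0].
have := lmax v; rewrite /qform va dotZl ler_pM2r //; exact: dot_gt0.
Qed.

Lemma qform_le_lambda_max H u : (0 < N)%N -> H^T = H ->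
  qform H u u <= lambda_max H * dot u u.
Proof. by move=> N0 sH; apply: (lambda_max_rayleigh H N0 sH).2. Qed.

(** The supremum in [lambda_max] is attained at an eigenvalue because [H] is
    symmetric, so that bounding the quadratic form bounds it from above. *)
Lemma lambda_max_le H b : (0 < N)%N -> H^T = H ->
  (forall v, qform H v v <= b * dot v v) -> lambda_max H <= b.
Proof.
move=> N0 sH Hb; have [/eigenvalueP[v va v0] _] := lambda_max_rayleigh H N0 sH.
have := Hb v; rewrite /qform va dotZl ler_pM2r //; exact: dot_gt0.
Qed.

End LambdaMax.

(** * Directional derivatives of functions of several variables *)

Lemma dist_half {R : realType} (a b c e : R) :
  `|a - c| < e / 2 -> `|b - c| < e / 2 -> `|b - a| <= e.
Proof.
move=> ac bc; have -> : b - a = (b - c) - (a - c) by lra.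
by apply: le_trans (ler_normB _ _) _; lra.
Qed.

Section Directional.
Context {R : realType} {V : normedModType R}.
Implicit Types (f : V -> R) (x p u v w : V) (h s t : R).

(** The derivative along [w] is the derivative of the restriction to a line of
    direction [w], which gives access to the one-variable theorems. *)
Lemma is_derive_line f p w t d :
  is_derive (p + t *: w) w f d <-> is_derive t 1 (fun s => f (p + s *: w)) d.
Proof.
have E : (fun h => h^-1 *: (f (h *: w + (p + t *: w)) - f (p + t *: w))) =
    (fun h => h^-1 *: (f (p + (h *: (1 : R) + t) *: w) - f (p + t *: w))).
  apply/funext => h; congr (_ *: (f _ - _)).
  by rewrite scalerDl [_%:A]mulr1 addrCA.
split=> -[dx dE]; split.
- by move: dx; rewrite /derivable E.
- by rewrite -dE /derive E.
- by move: dx; rewrite /derivable /= -E.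
- by rewrite -dE /derive /= -E.
Qed.

Lemma derivable_line f p w t : derivable f (p + t *: w) w ->
  is_derive t 1 (fun s => f (p + s *: w)) ('D_w f (p + t *: w)).
Proof. by move=> /derivableP/is_derive_line. Qed.

Lemma mvt_dir_pos f p u h : 0 <= h ->
  (forall s, 0 <= s <= h -> derivable f (p + s *: u) u) ->
  exists2 s, 0 <= s <= h & f (p + h *: u) - f p = h * 'D_u f (p + s *: u).
Proof.
move=> h0 df; have dg s : 0 <= s <= h ->
    is_derive s 1 (fun s => f (p + s *: u)) ('D_u f (p + s *: u)).
  by move=> sh; apply/derivable_line/df.
have [||s] := @MVT_segment R (fun s => f (p + s *: u))
   (fun s => 'D_u f (p + s *: u)) 0 h h0.
- by move=> s; rewrite in_itv /= => /andP[s0 sh]; apply: dg; rewrite !ltW.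
- by apply: derivable_within_continuous => s; rewrite in_itv /= => /dg[].
- rewrite in_itv /= => sh; rewrite scale0r addr0 subr0 mulrC => E.
  by exists s.
Qed.

Lemma mvt_dir f p u h :
  (forall s, `|s| <= `|h| -> derivable f (p + s *: u) u) ->
  exists2 s, `|s| <= `|h| & f (p + h *: u) - f p = h * 'D_u f (p + s *: u).
Proof.
move=> df; have [h0|h0] := leP 0 h.
  have [|s /andP[s0 sh] E] := mvt_dir_pos f p u h h0; last first.
    by exists s => //; rewrite !ger0_norm.
  by move=> s /andP[s0 sh]; apply: df; rewrite !ger0_norm.
have [| |s /andP[s0 sh]] := mvt_dir_pos f (p + h *: u) u (- h).
- by rewrite oppr_ge0 ltW.
- move=> s /andP[s0 sh]; rewrite -addrA -scalerDl; apply: df.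
  by rewrite (ltr0_norm h0) ler0_norm; lra.
- rewrite -!addrA -!scalerDl subrr scale0r addr0 => E.
  exists (h + s); first by rewrite (ltr0_norm h0) ler0_norm; lra.
  by apply: oppr_inj; rewrite opprB E mulNr.
Qed.

(** Pulls a neighbourhood back to the plane through [x] spanned by [u] and [v],
    where the mean value theorem produces its intermediate points. *)
Lemma near_plane (P : V -> Prop) x u v : (\forall y \near x, P y) ->
  exists2 d : R, 0 < d &
    forall h s, `|h| < d -> `|s| < d -> P (x + h *: u + s *: v).
Proof.
move=> /nbhs_ballP[e /= e0 xP]; pose d := e / (`|u| + `|v| + 1).
have m0 : 0 < `|u| + `|v| + 1 by rewrite ltr_wpDl // addr_ge0.
have d0 : 0 < d by rewrite divr_gt0.
exists d => // h s hd sd; apply: xP; rewrite -ball_normE /ball_ /=.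
rewrite -addrA opprD addrA subrr add0r normrN.
apply: le_lt_trans (ler_normD _ _) _; rewrite !normrZ.
apply: (@le_lt_trans _ _ (d * `|u| + d * `|v|)).
  by apply: lerD; rewrite ler_wpM2r // ltW.
have -> : e = d * (`|u| + `|v| + 1) by rewrite divfK // gt_eqF.
by rewrite -mulrDr ltr_pM2l // ltrDl.
Qed.

(** If the derivative along [u] is continuous, then the mean value theorem on
    the segment from [x + h v] to [x + h (a u + v)] makes the derivative
    additive in the direction. *)
Lemma derive_add_dir f x u v a :
  (\forall y \near x, derivable f y u) -> {for x, continuous ('D_u f)} ->
  derivable f x v ->
  is_derive x (a *: u + v) f (a * 'D_u f x + 'D_v f x).
Proof.
move=> du cu dv.
suff cvgu : h^-1 *: (f (h *: (a *: u + v) + x) - f x) @[h --> 0^'] -->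
    a * 'D_u f x + 'D_v f x.
  split; first by apply/cvg_ex; exists (a * 'D_u f x + 'D_v f x).
  by apply/cvg_lim => //; exact: cvgu.
have cvgv : h^-1 *: (f (h *: v + x) - f x) @[h --> 0^'] --> 'D_v f x by exact: dv.
suff cvgw : h^-1 *: (f (h *: (a *: u + v) + x) - f (h *: v + x)) @[h --> 0^'] -->
    a * 'D_u f x.
  apply/(cvg_trans _ (cvgD cvgw cvgv))/near_eq_cvg; near=> h.
  by rewrite -[LHS]scalerDr addrA subrK.
have [b b0 ab] : exists2 b : R, 0 < b & `|a| < b.
  by exists (`|a| + 1); [rewrite ltr_wpDl|rewrite ltrDl].
apply/cvgrPdist_lt => e e0.
have e'0 : 0 < e / b by rewrite divr_gt0.
have near2 : \forall y \near x, derivable f y u /\ `|'D_u f x - 'D_u f y| < e / b.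
  by apply/filterI => //; move/cvgrPdist_lt : cu; apply.
have [d d0 dP] := near_plane _ x v u near2.
have db : 0 < d / (b + 1) by rewrite divr_gt0 // addr_gt0.
near=> h.
have h0 : h != 0 by near: h; exact: nbhs_dnbhs_neq.
have hd : `|h| < d / (b + 1).
  by near: h; apply: dnbhs0_lt.
rewrite ltr_pdivlMr ?addr_gt0 // in hd.
have hd1 : `|h| < d.
  apply: le_lt_trans hd; rewrite ler_peMr // lerDr ltW //.
have had s : `|s| <= `|h * a| -> `|s| < d.
  move=> sh; apply: le_lt_trans sh _; rewrite normrM; apply: le_lt_trans hd.
  by rewrite ler_wpM2l // (le_trans (ltW ab)) // lerDl.
have [s /had sd] : exists2 s, `|s| <= `|h * a| &
    f (x + h *: v + (h * a) *: u) - f (x + h *: v) = h * a * 'D_u f (x + h *: v + s *: u).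
  by apply: mvt_dir => s /had sd; exact: (dP _ _ hd1 sd).1.
have -> : h *: (a *: u + v) + x = x + h *: v + (h * a) *: u.
  by rewrite scalerDr scalerA -addrA addrC (addrC (h *: v)).
rewrite (addrC (h *: v)) => ->.
rewrite [_ *: _]mulrA mulrA mulVf // mul1r -mulrBr normrM.
have [_ De] := dP _ _ hd1 sd.
rewrite -(divfK (lt0r_neq0 b0) e) mulrC.
by apply: (@le_lt_trans _ _ (e / b * `|a|));
  [rewrite ler_wpM2r // ltW|rewrite ltr_pM2l].
Unshelve. all: by end_near. Qed.

(** The mean value theorem, applied along [u] to the increment of [f] along [v]
    and then along [v] to ['D_u f]. *)
Lemma second_difference f x u v :
  (\forall y \near x, derivable f y u /\ derivable ('D_u f) y v) ->
  exists2 d : R, 0 < d & forall h, 0 < h < d ->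
    exists s t, [/\ `|s| <= h, `|t| <= h &
      f (x + h *: u + h *: v) - f (x + h *: u) - (f (x + h *: v) - f x) =
      h * (h * 'D_v ('D_u f) (x + s *: u + t *: v))].
Proof.
move=> nx; have [d d0 dP] := near_plane _ x u v nx.
exists d => // h /andP[h0 hd].
have hn : `|h| < d by rewrite gtr0_norm.
pose g s := f (x + h *: v + s *: u) - f (x + s *: u).
have lts s : 0 <= s <= h -> `|s| < d.
  by move=> /andP[s0 sh]; rewrite ger0_norm // (le_lt_trans sh).
have dg s : 0 <= s <= h -> is_derive s 1 g
    ('D_u f (x + h *: v + s *: u) - 'D_u f (x + s *: u)).
  move=> /lts sd; apply: is_deriveB; apply: derivable_line.
    by rewrite addrAC; apply: (dP _ _ sd hn).1.
  by have := (dP s 0 sd); rewrite normr0 scale0r addr0 => /(_ d0)[].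
have [||s] := @MVT_segment R g
    (fun s => 'D_u f (x + h *: v + s *: u) - 'D_u f (x + s *: u)) 0 h (ltW h0).
- by move=> s; rewrite in_itv /= => /andP[s0 sh]; apply: dg; rewrite !ltW.
- by apply: derivable_within_continuous => s; rewrite in_itv /= => /dg[].
rewrite in_itv /= => sh.
rewrite {1 2}/g !scale0r !addr0 subr0 => E.
have [|t th E2] := mvt_dir_pos ('D_u f) (x + s *: u) v h (ltW h0).
  move=> t th; apply: (dP _ _ (lts _ sh) (lts _ th)).2.
exists s, t; split.
- by move: sh => /andP[s0 sh]; rewrite ger0_norm.
- by move: th => /andP[t0 th]; rewrite ger0_norm.
- by rewrite -E2 (addrAC x (s *: u)) [RHS]mulrC -E (addrAC x (h *: u)).
Qed.

(** Schwarz's theorem: both mixed derivatives are limits of the same second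
    difference quotient. *)
Lemma derive_sym f x u v :
  (\forall y \near x, [/\ derivable f y u, derivable f y v,
     derivable ('D_u f) y v & derivable ('D_v f) y u]) ->
  {for x, continuous ('D_v ('D_u f))} -> {for x, continuous ('D_u ('D_v f))} ->
  'D_v ('D_u f) x = 'D_u ('D_v f) x.
Proof.
move=> nx cvu cuv; apply/eqP; rewrite -subr_eq0 -normr_le0.
apply/ler_addgt0Pr => e e0; rewrite add0r.
have e20 : 0 < e / 2 by rewrite divr_gt0.
have [|d1 d10 D1] := second_difference f x u v.
  by apply: filterS nx => y [].
have [|d2 d20 D2] := second_difference f x v u.
  by apply: filterS nx => y [].
move/cvgrPdist_lt : cvu => /(_ _ e20)/(near_plane _ x u v)[d3 d30 D3].
move/cvgrPdist_lt : cuv => /(_ _ e20)/(near_plane _ x v u)[d4 d40 D4].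
pose d := Num.min (Num.min d1 d2) (Num.min d3 d4).
have d0 : 0 < d by rewrite !lt_min d10 d20 d30 d40.
pose h := d / 2; have h0 : 0 < h by rewrite divr_gt0.
have hd : h < d by rewrite /h; lra.
move: (hd); rewrite !lt_min => /andP[/andP[hd1 hd2] /andP[hd3 hd4]].
have [|s [t [sh th E1]]] := D1 h; first by rewrite h0.
have [|s' [t' [sh' th' E2]]] := D2 h; first by rewrite h0.
have {}E : 'D_v ('D_u f) (x + s *: u + t *: v) = 'D_u ('D_v f) (x + s' *: v + t' *: u).
  apply: (@mulfI _ h); first exact: lt0r_neq0.
  apply: (@mulfI _ h); first exact: lt0r_neq0.
  have swap (A B C D : R) : A - B - (C - D) = A - C - (B - D) by ring.
  apply: etrans (esym E1) _; apply: etrans _ E2.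
  by rewrite (addrAC x (h *: v)) swap.
have := D3 _ _ (le_lt_trans sh hd3) (le_lt_trans th hd3).
have := D4 _ _ (le_lt_trans sh' hd4) (le_lt_trans th' hd4).
rewrite -E; exact: dist_half.
Qed.

End Directional.

Section SecondDerivativeTest.
Context {R : realType}.

(** Otherwise [g'], which vanishes at [a], is negative just to the right of [a],
    and [g] decreases there. *)
Lemma second_derivative_min (g g' : R -> R) (a c : R) :
  (\forall t \near a, is_derive t (1 : R) g (g' t)) -> is_derive a (1 : R) g' c ->
  (\forall t \near a, g a <= g t) -> 0 <= c.
Proof.
move=> dg dg' mg.
have /nbhs_ballP[d /= d0 dP] :
    \forall t \near a, is_derive t (1 : R) g (g' t) /\ g a <= g t.
  exact: filterI.
have inb t : a - d < t < a + d -> is_derive t (1 : R) g (g' t) /\ g a <= g t.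
  move=> td; apply: dP; rewrite -ball_normE /ball_ /= distrC ltr_distl //.
have ada : a \in `]a - d, a + d[ by rewrite in_itv /=; lra.
have g'a : g' a = 0.
  have : is_derive a (1 : R) g 0.
    apply: (@derive1_at_min R g (a - d) (a + d)) => //; first lra.
      by move=> t; rewrite in_itv /= => /inb[[]].
    by move=> t; rewrite in_itv /= => /inb[].
  move=> d1; have [d2 _] : is_derive a (1 : R) g (g' a) /\ g a <= g a by apply: inb; lra.
  by rewrite -(@derive_val _ _ _ _ _ _ _ d1) (@derive_val _ _ _ _ _ _ _ d2).
rewrite leNgt; apply/negP => c0.
have : h^-1 *: (g' (h *: 1 + a) - g' a) @[h --> 0^'] --> c.
  by case: dg' => dg' <-; exact: dg'.
move=> /cvgrPdist_lt/(_ (- c)); rewrite oppr_gt0 => /(_ c0).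
rewrite near_withinE => /nbhs_ballP[e /= e0 eP].
pose h := Num.min d e / 2.
have m0 : 0 < Num.min d e by rewrite lt_min d0 e0.
have hlt : h < Num.min d e by rewrite /h; lra.
have h0 : 0 < h by rewrite divr_gt0.
move: hlt; rewrite lt_min => /andP[hd he].
have neg t : a < t < a + h -> g' t < 0.
  move=> /andP[at_ th]; have := eP (t - a).
  rewrite -ball_normE /ball_ /= sub0r normrN gtr0_norm ?subr_gt0 //.
  have tae : t - a < e by lra.
  have ta : t - a != 0 by lra.
  move=> /(_ tae ta); rewrite [_%:A]mulr1 subrK g'a subr0.
  rewrite ltr_distl opprK gtrDr => /andP[+ _].
  by rewrite [_ *: _]mulrC pmulr_llt0 // invr_gt0 subr_gt0.
have [|||t] := @MVT R g g' a (a + h).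
- by lra.
- by move=> t; rewrite in_itv /= => /andP[t1 t2]; apply: (inb _ _).1; lra.
- apply: derivable_within_continuous => t; rewrite in_itv /= => /andP[t1 t2].
  by have [|[]] := inb t; first lra.
rewrite in_itv /= => /neg g't E.
have [|_] := inb (a + h); first lra.
rewrite -subr_ge0 E leNgt => /negP; apply.
by rewrite pmulr_llt0 //; lra.
Qed.

End SecondDerivativeTest.

(** * Second derivatives of twice continuously differentiable functions *)

Section Hessian.
Context {R : realType} {N : nat}.
Implicit Types (f psi : 'rV[R]_N -> R) (x v : 'rV[R]_N).

(** Adds up the coordinate directions one by one, with [derive_add_dir]. *)
Lemma derive_C1 f x v :
  (\forall y \near x, forall i, derivable f y (delta_mx 0 i)) ->
  (forall i, {for x, continuous (partial i f)}) ->
  is_derive x v f (\sum_i v 0 i * partial i f x).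
Proof.
move=> df cf; rewrite [X in is_derive _ X](row_sum_delta v).
elim: (index_enum _) => [|i s [ds Ds]].
  by rewrite !big_nil; exact: is_derive0.
rewrite !big_cons.
have di : \forall y \near x, derivable f y (delta_mx 0 i).
  by apply: filterS df => y; apply.
have := derive_add_dir f x (delta_mx 0 i) _ (v 0 i) di (cf i) ds.
by rewrite Ds.
Qed.

Lemma C2_hessian_sym psi x : C2_near psi x -> (hessian psi x)^T = hessian psi x.
Proof.
move=> C2; apply/matrixP => i j; rewrite !mxE /partial.
have [_ _ c2] := nbhs_singleton C2.
apply: derive_sym; [|exact: (c2 _ _).2|exact: (c2 _ _).2].
apply: filterS C2 => y [_ d1 d2]; split; first exact: (d1 _).1.
- exact: (d1 _).1.
- exact: (d2 _ _).1.
- exact: (d2 _ _).1.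
Qed.

Lemma C2_derive_line psi x v : C2_near psi x ->
  \forall t \near (0 : R), is_derive t (1 : R) (fun s => psi (x + s *: v))
     (\sum_i v 0 i * partial i psi (x + t *: v)).
Proof.
move=> C2; have C2' : \forall y \near x, C2_near psi y by apply: nbhs_interior.
have : \forall t \near (0 : R), C2_near psi (x + t *: v).
  have : (fun t : R => x + t *: v) t @[t --> 0] --> x + 0 *: v.
    by apply: cvgD; [exact: cvg_cst|exact: scalel_continuous].
  by rewrite scale0r addr0; apply.
apply: filterS => t Ct; apply: (is_derive_line psi x v t _).1.
have cp i : {for x + t *: v, continuous (partial i psi)}.
  by have [_ d1 _] := nbhs_singleton Ct; exact: (d1 i).2.
refine (derive_C1 psi (x + t *: v) v _ cp).
by apply: filterS Ct => y [_ d1 _] i; exact: (d1 i).1.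
Qed.

Lemma C2_derive2_line psi x v : C2_near psi x ->
  is_derive (0 : R) (1 : R) (fun t => \sum_i v 0 i * partial i psi (x + t *: v))
    (qform (hessian psi x) v v).
Proof.
move=> C2; have [_ _ c2] := nbhs_singleton C2.
have -> : qform (hessian psi x) v v =
    \sum_j v 0 j * \sum_i v 0 i * partial i (partial j psi) x.
  rewrite qformE exchange_big; apply: eq_bigr => j _; rewrite mulr_sumr.
  by apply: eq_bigr => i _; rewrite mxE; ring.
have -> : (fun t => \sum_i v 0 i * partial i psi (x + t *: v)) =
    \sum_i (fun t => v 0 i * partial i psi (x + t *: v)).
  by apply/funext => t; rewrite fct_sumE.
apply: is_derive_sum => j; apply: is_deriveZ.
apply: (is_derive_line (partial j psi) x v 0 _).1; rewrite scale0r addr0.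
have cp i : {for x, continuous (partial i (partial j psi))} by exact: (c2 i j).2.
refine (derive_C1 (partial j psi) x v _ cp).
by apply: filterS C2 => y [_ _ d2] i; exact: (d2 i j).1.
Qed.

(** The viscosity test along one line: [psi] touches [phi] from below at [x],
    so the second derivative of [phi - psi] along [v] is nonnegative. *)
Lemma touching_line psi (g g' : R -> R) c x v : C2_near psi x ->
  (\forall t \near (0 : R), is_derive t (1 : R) g (g' t)) ->
  is_derive (0 : R) (1 : R) g' c ->
  (\forall t \near (0 : R), g 0 - psi x <= g t - psi (x + t *: v)) ->
  qform (hessian psi x) v v <= c.
Proof.
move=> C2 dg dg' gmin; rewrite -subr_ge0.
apply: (@second_derivative_min _ (g - (fun t => psi (x + t *: v)))
   (g' - (fun t => \sum_i v 0 i * partial i psi (x + t *: v))) 0).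
- apply: filterS2 dg (C2_derive_line psi x v C2) => t d1 d2.
  exact: is_deriveB.
- by apply: is_deriveB; exact: C2_derive2_line.
- by apply: filterS gmin => t; rewrite /= !fctE scale0r addr0.
Qed.

End Hessian.

Section PointwiseContinuity.
Context {R : realType} {T : topologicalType}.
Implicit Types f g : T -> R.

Lemma continuous_addf {f g} : continuous f -> continuous g ->
  continuous (fun y => f y + g y).
Proof. by move=> cf cg y; apply: (@cvgD _ _ _ (nbhs y) _ f g); [exact: cf|exact: cg]. Qed.

Lemma continuous_mulf {f g} : continuous f -> continuous g ->
  continuous (fun y => f y * g y).
Proof. by move=> cf cg y; apply: (@cvgM _ _ (nbhs y) _ f g); [exact: cf|exact: cg]. Qed.

Lemma continuous_oppf {f} : continuous f -> continuous (fun y => - f y).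
Proof. by move=> cf y; apply: (@cvgN _ _ _ (nbhs y) _ f); exact: cf. Qed.

Lemma continuous_cstf k : continuous (fun _ : T => k : R).
Proof. by move=> y; exact: cvg_cst. Qed.

Lemma continuous_sinf {f} : continuous f -> continuous (fun y => sin (f y)).
Proof.
move=> cf y; suff : {for y, continuous (@sin R \o f)} by [].
by apply: continuous_comp; [exact: cf|exact: continuous_sin].
Qed.

Lemma continuous_cosf {f} : continuous f -> continuous (fun y => cos (f y)).
Proof.
move=> cf y; suff : {for y, continuous (@cos R \o f)} by [].
by apply: continuous_comp; [exact: cf|exact: continuous_cos].
Qed.

End PointwiseContinuity.

Lemma sub_continuous {R : realType} {N : nat} (x : 'rV[R]_N) :
  continuous (fun y : 'rV[R]_N => y - x).
Proof.
by move=> y; apply: (@cvgB _ _ _ (nbhs y) _ id (fun=> x)); [exact: cvg_id|exact: cvg_cst].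
Qed.

(** The next rules restate differentiation of sums, products and compositions
    for functions written pointwise, the form in which they occur below. *)

Section PointwiseRules.
Context {R : realType} {V : normedModType R}.
Implicit Types (f g : V -> R) (x v : V) (a b k : R).

Lemma is_derive_cstf {x v} k : is_derive x v (fun=> k) 0.
Proof. exact: is_derive_cst. Qed.

Lemma is_derive_addf {f g x v a b} : is_derive x v f a -> is_derive x v g b ->
  is_derive x v (fun s => f s + g s) (a + b).
Proof. by move=> df dg; exact: is_deriveD df dg. Qed.

Lemma is_derive_mulf {f g x v a b} : is_derive x v f a -> is_derive x v g b ->
  is_derive x v (fun s => f s * g s) (f x * b + g x * a).
Proof. by move=> df dg; exact: is_deriveM df dg. Qed.

Lemma is_derive_oppf {f x v a} : is_derive x v f a ->
  is_derive x v (fun s => - f s) (- a).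
Proof. by move=> df; exact: is_deriveN df. Qed.

Lemma is_derive_scalef {f x v a} k : is_derive x v f a ->
  is_derive x v (fun s => k * f s) (k * a).
Proof. by move=> df; exact: is_deriveZ df. Qed.

Lemma is_derive_invf {f x v a} : is_derive x v f a -> f x != 0 ->
  is_derive x v (fun s => (f s)^-1) (- f x ^- 2 * a).
Proof.
move=> [d <-] fx; split; first exact: derivableV.
exact: deriveV.
Qed.

Lemma is_derive_compf {h : R -> R} {f x v a b} :
  is_derive (f x) (1 : R) h b -> is_derive x v f a ->
  is_derive x v (fun s => h (f s)) (b * a).
Proof.
move=> dh df.
have d1 : is_derive (0 : R) (1 : R) (fun t : R => f (x + t *: v)) a.
  by apply: (is_derive_line f x v 0 a).1; rewrite scale0r addr0.
have dh' : is_derive (f (x + (0 : R) *: v)) (1 : R) h b by rewrite scale0r addr0.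
have := @is_derive1_comp R h (fun t : R => f (x + t *: v)) 0 b a dh' d1.
by move=> /(is_derive_line (fun s => h (f s)) x v 0 (b * a)).2; rewrite scale0r addr0.
Qed.

Lemma is_derive_sinf {f x v a} : is_derive x v f a ->
  is_derive x v (fun s => sin (f s)) (cos (f x) * a).
Proof. exact: is_derive_compf. Qed.

Lemma is_derive_cosf {f x v a} : is_derive x v f a ->
  is_derive x v (fun s => cos (f s)) (- sin (f x) * a).
Proof. exact: is_derive_compf. Qed.

End PointwiseRules.

Lemma is_derive_idf {R : realType} {t : R} : is_derive t (1 : R) (fun s : R => s) 1.
Proof. exact: is_derive_id. Qed.

Section DotRules.
Context {R : realType} {N : nat}.
Implicit Types x y u v : 'rV[R]_N.

Lemma is_derive_dotf {x y v} u :
  is_derive y v (fun z => dot (z - x) u) (dot v u).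
Proof.
rewrite -{1}[y]addr0 -[X in _ + X](scale0r v).
have D := is_derive_addf (is_derive_cstf (dot (y - x) u))
  (is_derive_mulf (@is_derive_idf _ (0 : R)) (is_derive_cstf (dot v u))).
apply: (is_derive_line (fun z => dot (z - x) u) y v 0 (dot v u)).2.
rewrite (_ : (fun s => _) = (fun s : R => dot (y - x) u + s * dot v u)); last first.
  by apply/funext => s; rewrite (addrAC y) (dotDl (y - x)) dotZl.
by apply: is_derive_eq D _; ring.
Qed.

Lemma is_derive_sqf {x y v} :
  is_derive y v (fun z => dot (z - x) (z - x)) (2 * dot (y - x) v).
Proof.
have D2 := is_derive_mulf (@is_derive_idf _ (0 : R)) (@is_derive_idf _ 0).
have D := is_derive_addf (is_derive_addf (is_derive_cstf (dot (y - x) (y - x)))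
  (is_derive_scalef (2 * dot (y - x) v) is_derive_idf))
  (is_derive_scalef (dot v v) D2).
rewrite -{1}[y]addr0 -[X in _ + X](scale0r v).
apply: (is_derive_line (fun z => dot (z - x) (z - x)) y v 0 _).2.
rewrite (_ : (fun s => _) = (fun s : R => dot (y - x) (y - x) +
    2 * dot (y - x) v * s + dot v v * (s * s))); last first.
  by apply/funext => s; rewrite (addrAC y (s *: v)); move: (y - x) => p;
    rewrite !dotE (dotC v p); ring.
by apply: is_derive_eq D _; ring.
Qed.

End DotRules.

(** * The principal eigenvalue of a ball is at least [(pi / 2r)^2] *)

Section BallEigenfunction.
Context {R : realType}.

(** [sin x - x cos x] vanishes at 0 and has derivative [x sin x]. *)
Lemma mulr_cos_le_sin (x : R) : 0 <= x <= pi / 2 -> x * cos x <= sin x.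
Proof.
move=> /andP[x0 xpi].
pose F (y : R) := sin y - y * cos y.
have dF (y : R) : is_derive y (1 : R) F (y * sin y).
  have D := is_derive_addf (is_derive_sin y) (is_derive_oppf
    (is_derive_mulf (@is_derive_idf _ y) (is_derive_cos y))).
  by apply: is_derive_eq D _; ring.
have : F 0 <= F x.
  apply: (@ger0_derive1_ndecr R F 0 (pi / 2)) => //.
  - move=> y; rewrite in_itv /= => /andP[y0 ypi].
    rewrite derive1E (@derive_val _ _ _ _ _ _ _ (dF y)) mulr_ge0 ?ltW //.
    apply: sin_gt0_pihalf; by rewrite y0.
  - by apply: derivable_within_continuous => y _; have [] := dF y.
by rewrite /F sin0 mul0r subr0 subr_ge0.
Qed.

Lemma is_derive_quadratic (a b e t : R) :
  is_derive t (1 : R) (fun s => a + b * s + e * s ^+ 2) (b + 2 * e * t).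
Proof.
have D1 := @is_derive_idf _ t; have D2 := is_derive_mulf D1 D1.
have D := is_derive_addf (is_derive_addf (is_derive_cstf a)
  (is_derive_scalef b D1)) (is_derive_scalef e D2).
by apply: is_derive_eq D _; ring.
Qed.

(** The two derivatives at 0 of [cos (k |p + t v|)] for [p != 0], where
    [a = |p|^2], [b = <p, v>] and [e = |v|^2]. *)
Lemma is_derive2_cos_norm (k a b e : R) : 0 < a ->
  let s t := a + (2 * b) * t + e * t ^+ 2 in
  let g' t := - (k * (sin (k * Num.sqrt (s t)) * ((Num.sqrt (s t))^-1 * (b + e * t)))) in
  let q := Num.sqrt a in
  (\forall t \near (0 : R),
     is_derive t (1 : R) (fun u => cos (k * Num.sqrt (s u))) (g' t)) /\
  is_derive (0 : R) (1 : R) g'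
    (- (k ^+ 2 * cos (k * q) * (b ^+ 2 / a) + k * sin (k * q) / q * (e - b ^+ 2 / a))).
Proof.
move=> a0 s g' q.
have ds t : is_derive t (1 : R) s (2 * b + 2 * e * t) by exact: is_derive_quadratic.
have dsq t : 0 < s t -> is_derive t (1 : R) (fun u => Num.sqrt (s u))
    ((Num.sqrt (s t))^-1 * (b + e * t)).
  move=> st; have D : is_derive t (1 : R) (fun u => Num.sqrt (s u))
      ((2 * Num.sqrt (s t))^-1 * (2 * b + 2 * e * t)).
    by apply: (@is_derive1_comp R Num.sqrt s); exact: is_derive1_sqrt.
  by apply: is_derive_eq D _; field; rewrite gt_eqF // sqrtr_gt0.
have s0 : s 0 = a by rewrite /s; ring.
have st0 : 0 < s 0 by rewrite s0.
have q0 : 0 < q by rewrite sqrtr_gt0.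
have qa : q ^+ 2 = a by rewrite sqr_sqrtr // ltW.
split.
  have cs : s t @[t --> (0 : R)] --> s 0.
    by apply: differentiable_continuous; apply/derivable1_diffP; have [] := ds 0.
  have : \forall t \near (0 : R), 0 < s t by apply: cvgr_gt cs _ _.
  apply: filterS => t /dsq d.
  have D : is_derive t (1 : R) (fun u => cos (k * Num.sqrt (s u)))
      (- sin (k * Num.sqrt (s t)) * (k * ((Num.sqrt (s t))^-1 * (b + e * t)))).
    by apply: is_derive_cosf; exact: is_derive_scalef.
  by apply: is_derive_eq D _; rewrite /g'; ring.
have d0 := dsq _ st0; rewrite s0 -/q in d0.
have dk := is_derive_scalef k d0.
have d1 := is_derive_sinf dk.
have sq0 : Num.sqrt (s 0) != 0 by rewrite s0 gt_eqF.
have d2 := is_derive_invf d0 sq0.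
have d3 := is_derive_addf (is_derive_cstf b)
  (is_derive_scalef e is_derive_idf).
have D := is_derive_oppf (is_derive_scalef k
  (is_derive_mulf d1 (is_derive_mulf d2 (d3 0)))).
apply: is_derive_eq D _.
rewrite s0 -/q -qa; field; exact: lt0r_neq0.
Qed.

(** The second derivative of [t |-> cos (k |p + t v|)] at 0 is at most
    [- k^2 cos (k |p|) |v|^2]: in the radial direction there is equality, in the
    orthogonal directions this is [k |p| <= tan (k |p|)]. *)
Lemma cos_norm_line (N : nat) (k : R) (p v : 'rV[R]_N) :
  0 < k -> 0 <= k * enorm p <= pi / 2 ->
  exists g' c, [/\
    \forall t \near (0 : R),
      is_derive t (1 : R) (fun u => cos (k * enorm (p + u *: v))) (g' t),
    is_derive (0 : R) (1 : R) g' c &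
    c <= - (k ^+ 2 * cos (k * enorm p)) * dot v v].
Proof.
move=> k0 /andP[kp0 kp].
have nE t : enorm (p + t *: v) =
    Num.sqrt (dot p p + (2 * dot p v) * t + dot v v * t ^+ 2).
  by rewrite enormE !dotE (dotC v p); congr Num.sqrt; ring.
have [p0|p0] := eqVneq p 0.
  pose n := enorm v.
  have E : (fun u => cos (k * enorm (p + u *: v))) = (fun u => cos (k * n * u)).
    apply/funext => u; rewrite p0 add0r enormE !dotE mulrA -expr2.
    rewrite sqrtrM ?sqr_ge0 // sqrtr_sqr -enormE -cos_norm -[RHS]cos_norm.
    by rewrite !normrM normr_id; congr cos; rewrite -/n; ring.
  have lin t : is_derive t (1 : R) (fun u => k * n * u) (k * n * 1).
    by apply: is_derive_scalef; exact: is_derive_idf.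
  exists (fun t => - sin (k * n * t) * (k * n)), (- (k ^+ 2 * dot v v)); split.
  - near=> t; rewrite E; have D := is_derive_cosf (lin t).
    by apply: is_derive_eq D _; rewrite mulr1.
  - have D := is_derive_mulf (is_derive_oppf
      (is_derive_sinf (lin 0))) (is_derive_cstf (k * n)).
    by apply: is_derive_eq D _; rewrite (mulr0 (k * n)) cos0 -enorm_sqr -/n; ring.
  - rewrite p0 enormE.
    have -> : dot (0 : 'rV[R]_N) 0 = 0 by apply/eqP; rewrite dot_eq0.
    by rewrite sqrtr0 mulr0 cos0; lra.
have a0 := dot_gt0 p p0.
have [D1 D2] := is_derive2_cos_norm k (dot p p) (dot p v) (dot v v) a0.
eexists; eexists; split; [|exact: D2|].
  by apply: filterS D1 => t; under eq_fun do rewrite -nE.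
rewrite -enormE.
set q := enorm p in kp kp0 *; have qa : dot p p = q ^+ 2 by rewrite enorm_sqr.
have q0 : 0 < q by rewrite /q enormE sqrtr_gt0.
have S := mulr_cos_le_sin (k * q); rewrite kp0 kp in S.
have {}S : k * cos (k * q) <= sin (k * q) / q.
  by rewrite ler_pdivlMr // mulrAC; exact: S.
have CS : 0 <= dot v v - dot p v ^+ 2 / dot p p.
  by rewrite subr_ge0 ler_pdivrMr // mulrC dot_CS.
rewrite mulNr lerN2.
set w := dot v v in CS *; set z := dot p v ^+ 2 / dot p p in CS *.
have -> : k ^+ 2 * cos (k * q) * w =
    k ^+ 2 * cos (k * q) * z + k * (k * cos (k * q)) * (w - z).
  by ring.
by rewrite lerD2l ler_wpM2r // -mulrA ler_wpM2l // ltW.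
Unshelve. all: by end_near. Qed.

Lemma enorm_continuous (N : nat) : continuous (@enorm R N).
Proof.
move=> x; rewrite (_ : @enorm R N = Num.sqrt \o (fun u => dot u u)).
  by apply: continuous_comp; [exact: dot_continuous|exact: sqrt_continuous].
by apply/funext => u; rewrite enormE.
Qed.

Lemma enorm_sub_continuous (N : nat) (c : 'rV[R]_N) :
  continuous (fun y : 'rV[R]_N => enorm (y - c)).
Proof.
move=> x; suff : {for x, continuous (@enorm R N \o (fun y : 'rV[R]_N => y - c))} by [].
by apply: continuous_comp; [exact: sub_continuous|exact: enorm_continuous].
Qed.

Lemma eball_open (N : nat) (c : 'rV[R]_N) (r : R) : open (eball c r).
Proof.
rewrite (_ : eball c r = (fun y : 'rV[R]_N => enorm (y - c)) @^-1` [set t | t < r]) //.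
by apply: open_comp => [x _|]; [exact: enorm_sub_continuous|exact: open_lt].
Qed.

(** The function [cos (k |x - c|)] with [k = pi / 2r] is positive in the ball,
    and its second derivatives in all directions are at most [- k^2] times its
    value; by the second derivative test this passes to the Hessian of any
    function touching it from below. *)
Lemma mu1_ball_ge (N : nat) (c : 'rV[R]_N) (r : R) : (0 < N)%N -> 0 < r ->
  (((pi / (2 * r)) ^+ 2)%:E <= mu1 (eball c r))%E.
Proof.
move=> N0 r0; set k := pi / (2 * r).
have k0 : 0 < k by rewrite divr_gt0 ?pi_gt0 ?mulr_gt0.
pose phi (x : 'rV[R]_N) : R := cos (k * enorm (x - c)).
have kin x : eball c r x -> 0 <= k * enorm (x - c) < pi / 2.
  rewrite /eball /= => xr; rewrite mulr_ge0 ?enorm_ge0 ?(ltW k0) //=.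
  have -> : pi / 2 = k * r by rewrite /k; field; exact: lt0r_neq0.
  by rewrite ltr_pM2l.
have phic : continuous phi.
  move=> x; suff : {for x, continuous (cos \o (fun y => k * enorm (y - c)))} by [].
  apply: continuous_comp; last exact: continuous_cos.
  apply: (@cvgMl_tmp _ _ (nbhs x) _ (fun y : 'rV[R]_N => enorm (y - c))).
  exact: enorm_sub_continuous.
apply: ereal_sup_ubound; exists (k ^+ 2) => //; exists phi; split.
- move=> x a; rewrite lte_fin => ax.
  have phicw : {within eball c r, continuous phi} by exact: continuous_subspaceT.
  exists [set y : subspace (eball c r) | a < phi y]; last by move=> y; rewrite lte_fin.
  have ga : nbhs (phi x) [set t | a < t] by exact: lt_nbhsr.
  exact: (phicw x _ ga).
- move=> x /kin /andP[h0 h1]; apply: cos_gt0_pihalf; rewrite h1 andbT.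
  by apply: lt_le_trans h0; rewrite oppr_lt0 divr_gt0 ?pi_gt0.
- move=> x psi /[dup] xO /kin /andP[h0 h1] C2 xmin _.
  rewrite lerNr; apply: lambda_max_le => //; first exact: C2_hessian_sym.
  move=> v; have [|g' [d [D1 D2 dle]]] := cos_norm_line N k (x - c) v k0.
    by rewrite h0 ltW.
  rewrite -mulNr in dle *; apply: le_trans dle.
  apply: (touching_line _ _ _ _ x v C2 D1 D2).
  have oB : \forall t \near (0 : R), (eball c r (x + t *: v)) /\
      (eball c r (x + t *: v) -> phi x - psi x <= phi (x + t *: v) - psi (x + t *: v)).
    have lc : (x + t *: v) @[t --> (0 : R)] --> x.
      rewrite -{2}[x]addr0 -(scale0r v).
      by apply: cvgD; [exact: cvg_cst|exact: scalel_continuous].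
    have xO' := open_nbhs_nbhs (conj (eball_open N c r) xO).
    exact: (lc _ (filterI xO' xmin)).
  apply: filterS oB => t [tB /(_ tB)]; rewrite /phi scale0r addr0.
  by rewrite (addrAC x).
Qed.

End BallEigenfunction.

(** * An upper bound from the segments contained in the domain *)

Section UscMax.
Context {R : realType} {T : topologicalType}.

(** If no point were a maximum, the superlevel sets would generate a filter
    with no cluster point in [K]. *)
Lemma usc_compact_max (K : set T) (g : T -> R) : compact K -> K !=set0 ->
  (forall x a, K x -> g x < a -> \forall y \near x, K y -> g y < a) ->
  exists2 x, K x & forall y, K y -> g y <= g x.
Proof.
move=> cK [x0 Kx0] ug; pose F := filter_from K (fun y => [set x | K x /\ g y <= g x]).
have FF : ProperFilter F.
  apply: filter_from_proper; last by move=> y Ky; exists y.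
  apply: filter_from_filter; first by exists x0.
  move=> y z Ky Kz; have [yz|zy] := leP (g y) (g z).
    by exists z => // x [Kx zx]; split; split => //; exact: le_trans zx.
  by exists y => // x [Kx yx]; split; split => //; rewrite (le_trans (ltW zy)).
have FK : F K by exists x0 => // x [].
have [x [Kx cx]] := cK F FF FK.
exists x => // y Ky; rewrite leNgt; apply/negP => xy.
have Fy : F [set z | K z /\ g y <= g z] by exists y.
have [z [[Kz yz] zy]] := cx _ _ Fy (ug x _ Kx xy).
by move: (zy Kz); rewrite ltNge yz.
Qed.

End UscMax.

Definition segment_closed {R : realType} {N : nat} (A : set 'rV[R]_N) :=
  forall x y t, 0 <= t <= 1 -> A x -> A y -> A (t *: x + (1 - t) *: y).

Lemma convex_segment_closed {R : realType} {N : nat} (A : set 'rV[R]_N) :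
  convex_set (A : set (convex_lmodType 'rV[R]_N)) -> segment_closed A.
Proof.
move=> cA x y t /andP[t0 t1] Ax Ay.
by have := cA x y (Itv01 t0 t1); rewrite !inE => /(_ Ax Ay).
Qed.

Lemma eball_segment_closed {R : realType} {N : nat} (c : 'rV[R]_N) (r : R) :
  0 < r -> segment_closed (eball c r).
Proof.
move=> r0 x y t /andP[t0 t1]; rewrite /eball /= !enorm_lt // => xr yr.
have -> : t *: x + (1 - t) *: y - c = t *: (x - c) + (1 - t) *: (y - c).
  by apply/rowP => j; rewrite !mxE; ring.
move: (x - c) (y - c) xr yr => u v xr yr.
have := dot_ge0 (u - v); rewrite !dotE (dotC v u) => uv.
have uv' : 0 <= t * (1 - t) * (dot u u - 2 * dot u v + dot v v).
  by rewrite !mulr_ge0 ?subr_ge0 //; lra.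
have [->|tn0] := eqVneq t 0; first by rewrite !(mul0r, add0r, subr0, mul1r).
have tp : 0 < t by rewrite lt_def tn0.
have h1 : t * dot u u < t * r ^+ 2 by rewrite ltr_pM2l.
have h2 : (1 - t) * dot v v <= (1 - t) * r ^+ 2 by rewrite ler_wpM2l ?subr_ge0 // ltW.
lra.
Qed.

(** When the directional derivatives are known in closed form for all directions,
    the quadratic form of the Hessian is read off as the second derivative along
    a line. *)
Lemma hessian_of_formulas {R : realType} {N : nat} (w : 'rV[R]_N -> R)
    (Dw : 'rV[R]_N -> 'rV[R]_N -> R) (DDw : 'rV[R]_N -> 'rV[R]_N -> 'rV[R]_N -> R) :
  (forall v y, is_derive y v w (Dw v y)) ->
  (forall u v y, is_derive y u (Dw v) (DDw u v y)) ->
  continuous w -> (forall v, continuous (Dw v)) ->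
  (forall u v, continuous (DDw u v)) ->
  forall x, C2_near w x /\ forall v, qform (hessian w x) v v = DDw v v x.
Proof.
move=> d1 d2 c0 c1 c2 x.
have pE i : partial i w = Dw (delta_mx 0 i).
  by apply/funext => y; rewrite /partial (@derive_val _ _ _ _ _ _ _ (d1 _ _)).
have ppE i j : partial i (partial j w) = DDw (delta_mx 0 i) (delta_mx 0 j).
  rewrite pE; apply/funext => y.
  by rewrite /partial (@derive_val _ _ _ _ _ _ _ (d2 _ _ _)).
have C2 : C2_near w x.
  rewrite /C2_near; apply: filterE => y; split; first exact: c0.
    move=> i; split; first by have [] := d1 (delta_mx 0 i) y.
    by rewrite pE; exact: c1.
  move=> i j; split; last by rewrite ppE; exact: c2.
  by rewrite pE; have [] := d2 (delta_mx 0 i) (delta_mx 0 j) y.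
split=> // v; have D2 := C2_derive2_line w x v C2.
have E : (fun t => \sum_i v 0 i * partial i w (x + t *: v)) =
    (fun t => Dw v (x + t *: v)).
  apply/funext => t; set y := x + _.
  have D : is_derive y v w (\sum_i v 0 i * partial i w y).
    apply: derive_C1; first by apply: filterE => z i; have [] := d1 (delta_mx 0 i) z.
    by move=> i; rewrite pE; exact: c1.
  by rewrite -(@derive_val _ _ _ _ _ _ _ D) (@derive_val _ _ _ _ _ _ _ (d1 v y)).
have D3 : is_derive (0 : R) (1 : R) (fun t => Dw v (x + t *: v)) (DDw v v x).
  by apply: (is_derive_line (Dw v) x v 0 _).1; rewrite scale0r addr0.
rewrite E in D2.
by rewrite -(@derive_val _ _ _ _ _ _ _ D2) (@derive_val _ _ _ _ _ _ _ D3).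
Qed.

Section TestFunction.
Context {R : realType} {N : nat}.
Variables (x e : 'rV[R]_N) (k d s : R).
Hypothesis e1 : dot e e = 1.
Implicit Types y u v : 'rV[R]_N.

Let tau y := dot (y - x) e.

(** [d^2] minus the squared distance of [y] to the line through [x] directed by
    the unit vector [e]. *)
Definition tube_profile y : R := d ^+ 2 - (dot (y - x) (y - x) - tau y * tau y).

Let P := tube_profile.

(** A sine along the axis times a profile vanishing on the lateral boundary. *)
Definition tube_test y : R := s * (sin (k * tau y) * P y).

Let DP v y := - (2 * dot (y - x) v) + 2 * dot v e * tau y.

Let DDP u v := - (2 * dot u v) + 2 * dot v e * dot u e.

Let Dw v y := s * (k * dot v e * (cos (k * tau y) * P y) + sin (k * tau y) * DP v y).

Let DDw u v y :=
  s * (k * dot v e *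
         (cos (k * tau y) * DP u y - k * dot u e * (sin (k * tau y) * P y)) +
       (k * dot u e * (cos (k * tau y) * DP v y) + sin (k * tau y) * DDP u v)).

Let dtau v y : is_derive y v tau (dot v e).
Proof. exact: is_derive_dotf. Qed.

Let dP v y : is_derive y v P (DP v y).
Proof.
have D := is_derive_addf (is_derive_cstf (d ^+ 2)) (is_derive_oppf
  (is_derive_addf (@is_derive_sqf _ _ x y v) (is_derive_oppf
    (is_derive_mulf (dtau v y) (dtau v y))))).
by apply: is_derive_eq D _; rewrite /DP; ring.
Qed.

Let dDP u v y : is_derive y u (DP v) (DDP u v).
Proof.
have D := is_derive_addf
  (is_derive_oppf (is_derive_scalef 2 (@is_derive_dotf _ _ x y u v)))
  (is_derive_scalef (2 * dot v e) (dtau u y)).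
exact: D.
Qed.

Let dw v y : is_derive y v tube_test (Dw v y).
Proof.
have dk := is_derive_scalef k (dtau v y).
have D := is_derive_scalef s (is_derive_mulf (is_derive_sinf dk) (dP v y)).
by apply: is_derive_eq D _; rewrite /Dw; ring.
Qed.

Let ddw u v y : is_derive y u (Dw v) (DDw u v y).
Proof.
have dk := is_derive_scalef k (dtau u y).
have D := is_derive_scalef s (is_derive_addf
  (is_derive_scalef (k * dot v e) (is_derive_mulf (is_derive_cosf dk) (dP u y)))
  (is_derive_mulf (is_derive_sinf dk) (dDP u v y))).
by apply: is_derive_eq D _; rewrite /DDw; ring.
Qed.

Lemma tube_coord_continuous : continuous tau.
Proof.
move=> y; suff : {for y, continuous ((fun z => dot z e) \o (fun z : 'rV[R]_N => z - x))} by [].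
by apply: continuous_comp; [exact: sub_continuous|exact: dotr_continuous].
Qed.

Lemma tube_profile_continuous : continuous tube_profile.
Proof.
have ct := tube_coord_continuous.
apply: (continuous_addf (continuous_cstf _)); apply: continuous_oppf.
apply: continuous_addf; last by apply/continuous_oppf/continuous_mulf.
move=> y; suff : {for y, continuous ((fun z => dot z z) \o (fun z : 'rV[R]_N => z - x))} by [].
by apply: continuous_comp; [exact: sub_continuous|exact: dot_continuous].
Qed.

Let cDP v : continuous (DP v).
Proof.
apply: continuous_addf.
  apply/continuous_oppf/(continuous_mulf (continuous_cstf _)) => y.
  suff : {for y, continuous ((fun z => dot z v) \o (fun z : 'rV[R]_N => z - x))} by [].
  by apply: continuous_comp; [exact: sub_continuous|exact: dotr_continuous].
exact: (continuous_mulf (continuous_cstf _) tube_coord_continuous).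
Qed.

Let ck : continuous (fun y => k * tau y).
Proof. exact: (continuous_mulf (continuous_cstf _) tube_coord_continuous). Qed.

Lemma tube_test_continuous : continuous tube_test.
Proof.
apply: (continuous_mulf (continuous_cstf _)).
exact: (continuous_mulf (continuous_sinf ck) tube_profile_continuous).
Qed.

Let cDw v : continuous (Dw v).
Proof.
apply: (continuous_mulf (continuous_cstf _)); apply: continuous_addf.
  apply: (continuous_mulf (continuous_cstf _)).
  exact: (continuous_mulf (continuous_cosf ck) tube_profile_continuous).
exact: (continuous_mulf (continuous_sinf ck) (cDP v)).
Qed.

Let cDDw u v : continuous (DDw u v).
Proof.
apply: (continuous_mulf (continuous_cstf _)); apply: continuous_addf.
  apply: (continuous_mulf (continuous_cstf _)); apply: continuous_addf.
    exact: (continuous_mulf (continuous_cosf ck) (cDP u)).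
  apply: continuous_oppf; apply: (continuous_mulf (continuous_cstf _)).
  exact: (continuous_mulf (continuous_sinf ck) tube_profile_continuous).
apply: continuous_addf.
  apply: (continuous_mulf (continuous_cstf _)).
  exact: (continuous_mulf (continuous_cosf ck) (cDP v)).
exact: (continuous_mulf (continuous_sinf ck) (continuous_cstf _)).
Qed.

(** Along the axis of the tube the profile is constant and only the sine is
    differentiated. *)
Lemma tube_test_C2 z : C2_near tube_test z /\
  qform (hessian tube_test z) e e = - k ^+ 2 * tube_test z.
Proof.
have [C2 H] := hessian_of_formulas _ Dw DDw dw ddw tube_test_continuous cDw cDDw z.
split=> //; rewrite H /DDw /DP /DDP /tube_test e1 -/(tau z); ring.
Qed.

End TestFunction.

Section SegmentBound.
Context {R : realType} {N : nat}.
Implicit Types (Omega : set 'rV[R]_N) (x y z e : 'rV[R]_N).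

Lemma open_eball_sub Omega x : open Omega -> Omega x ->
  exists2 d : R, 0 < d & eball x d `<=` Omega.
Proof.
move=> oO Ox; have /nbhs_ballP[d /= d0 dP] := open_nbhs_nbhs (conj oO Ox).
exists d => // y xy; apply: dP; rewrite -ball_normE /ball_ /= distrC.
exact: le_lt_trans (norm_le_enorm _) xy.
Qed.

(** [LSC] refers to the topology of the subspace [Omega]; as [Omega] is open,
    its neighbourhoods are neighbourhoods in the whole space. *)
Lemma LSC_near Omega (phi : 'rV[R]_N -> R) x a : open Omega -> LSC Omega phi ->
  Omega x -> a < phi x -> \forall y \near x, a < phi y.
Proof.
move=> oO lO Ox ax; have [V + VP] := lO x a ax.
rewrite /nbhs /= -nbhs_subspace_in // => /= Vx.
have oN := open_nbhs_nbhs (conj oO Ox).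
by apply: filterS2 oN Vx => y Oy /(_ Oy) /VP.
Qed.

Definition tube x e (l d : R) : set 'rV[R]_N :=
  [set z | [/\ 0 <= dot (z - x) e, dot (z - x) e <= l & 0 <= tube_profile x e d z]].

Lemma tube_compact x e l d : 0 <= l -> compact (tube x e l d).
Proof.
move=> l0; apply: bounded_closed_compact.
  exists (`|x| + Num.sqrt (d ^+ 2 + l ^+ 2)); split; first exact: num_real.
  move=> M hM z [z0 zl zP]; apply: le_trans (ltW hM).
  rewrite -(subrK x z) addrC; apply: le_trans (ler_normD _ _) _; rewrite lerD2l.
  apply: le_trans (norm_le_enorm _) _; rewrite enormE ler_wsqrtr //.
  move: zP; rewrite /tube_profile; set a := dot _ e in z0 zl *; set b := dot _ _.
  have : a * a <= l ^+ 2 by rewrite -expr2 lerXn2r // nnegrE.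
  by lra.
have ct : continuous (fun z => dot (z - x) e) by exact: tube_coord_continuous.
rewrite (_ : tube x e l d = ((fun z => dot (z - x) e) @^-1` [set t | 0 <= t]
   `&` (fun z => dot (z - x) e) @^-1` [set t | t <= l])
   `&` (tube_profile x e d) @^-1` [set t | 0 <= t]).
  apply: closedI; first apply: closedI.
  - by apply: closed_comp => [z _|]; [exact: ct|exact: closed_ge].
  - by apply: closed_comp => [z _|]; [exact: ct|exact: closed_le].
  - by apply: closed_comp => [z _|]; [exact: tube_profile_continuous|exact: closed_ge].
by apply/seteqP; split => z /=; [move=> [? ? ?]|move=> [[? ?] ?]].
Qed.

(** The tube is contained in the convex hull of the two balls around the
    endpoints of its axis. *)
Lemma tube_sub Omega x e l d d' : dot e e = 1 -> 0 < l -> 0 <= d < d' ->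
  segment_closed Omega ->
  eball x d' `<=` Omega -> eball (x + l *: e) d' `<=` Omega ->
  tube x e l d `<=` Omega.
Proof.
move=> e1 l0 /andP[d0 dd'] cO Bx By z [z0 zl zP].
pose t := dot (z - x) e; pose p := z - x - t *: e.
have d'0 : 0 < d' by lra.
have pd : enorm p < d'.
  have dd2 : d ^+ 2 < d' ^+ 2 by rewrite ltrXn2r // nnegrE ?(ltW d'0).
  rewrite enorm_lt //; apply: le_lt_trans dd2; move: zP.
  rewrite /tube_profile /p /t; move: (z - x) => q.
  by rewrite !dotE (dotC e q) e1; lra.
have -> : z = (1 - t / l) *: (x + p) + (1 - (1 - t / l)) *: (x + l *: e + p).
  by apply/rowP => i; rewrite /p !mxE; field; exact: lt0r_neq0.
apply: cO.
- by rewrite subr_ge0 lerBlDr lerDl ler_pdivrMr // mul1r zl divr_ge0 // ltW.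
- by apply: Bx; rewrite /eball /= addrAC subrr add0r.
- by apply: By; rewrite /eball /= addrAC subrr add0r.
Qed.

(** On a thin tube around the segment from [x] to [y], the ratio of the sine
    profile [w] to a positive supersolution [phi] has a positive maximum [m],
    attained inside the tube because [w] vanishes on its boundary. There
    [w / m] touches [phi] from below. Its second derivative along the axis is
    [- (pi / l)^2] times its value, and this is a lower bound for the largest
    eigenvalue of its Hessian, hence [mu <= (pi / l)^2]. *)
Lemma mu1_segment_le Omega x y : (0 < N)%N -> open Omega ->
  segment_closed Omega ->
  Omega x -> Omega y -> x != y ->
  (mu1 Omega <= ((pi / enorm (y - x)) ^+ 2)%:E)%E.
Proof.
move=> N0 oO cO Ox Oy xy; set l := enorm (y - x); set k := pi / l.
have l0 : 0 < l.
  by rewrite /l enormE sqrtr_gt0 dot_gt0 // subr_eq0 eq_sym.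
have k0 : 0 < k by rewrite divr_gt0 ?pi_gt0.
pose e := l^-1 *: (y - x).
have e1 : dot e e = 1.
  by rewrite !dotZl !dotZr -enorm_sqr -/l; field; exact: lt0r_neq0.
have yE : y = x + l *: e.
  by rewrite scalerA divff ?lt0r_neq0 // scale1r addrC subrK.
have [d1 d10 B1] := open_eball_sub Omega x oO Ox.
have [d2 d20 B2] := open_eball_sub Omega y oO Oy.
pose d' := Num.min d1 d2; pose d := d' / 2.
have d'0 : 0 < d' by rewrite lt_min d10.
have d0 : 0 < d by rewrite divr_gt0.
have dd' : d < d' by rewrite /d; lra.
have TO : tube x e l d `<=` Omega.
  apply: (tube_sub Omega x e l d d') => //; first by rewrite ltW.
    by move=> z zx; apply: B1; apply: lt_le_trans zx _; rewrite ge_min lexx.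
  rewrite -yE => z zy; apply: B2; apply: lt_le_trans zy _.
  by rewrite ge_min lexx orbT.
apply: ge_ereal_sup => _ [mu [phi [lphi phi0 vphi]] <-]; rewrite lee_fin.
pose w := tube_test x e k d 1.
have w0 z : tube x e l d z -> 0 <= w z.
  move=> [z0 zl zP]; rewrite /w /tube_test mul1r mulr_ge0 //.
  apply: sin_ge0_pi; rewrite mulr_ge0 ?(ltW k0) //=.
  by rewrite /k mulrAC ler_pdivrMr // ler_pM2l ?pi_gt0.
pose z1 := x + (l / 2) *: e.
have z1e : dot (z1 - x) e = l / 2.
  by rewrite /z1 (addrC x) addrK dotZl e1 mulr1.
have z1P : tube_profile x e d z1 = d ^+ 2.
  by rewrite /tube_profile z1e /z1 (addrC x) addrK dotZl dotZr e1; ring.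
have Tz1 : tube x e l d z1.
  by split; rewrite ?z1e ?z1P ?sqr_ge0 //; lra.
have wz1 : 0 < w z1.
  rewrite /w /tube_test mul1r z1e z1P (_ : k * (l / 2) = pi / 2).
    by rewrite sin_pihalf mul1r exprn_gt0.
  by rewrite /k; field; exact: lt0r_neq0.
have [|||z Tz zmax] := @usc_compact_max _ _ (tube x e l d) (fun z => w z / phi z).
- by apply: tube_compact; exact: ltW.
- by exists z1.
- move=> z a Tz za.
  have pz := phi0 _ (TO _ Tz).
  have a0 : 0 < a by apply: le_lt_trans za; rewrite divr_ge0 ?w0 // ltW.
  rewrite ltr_pdivrMr // in za.
  pose b := (w z / a + phi z) / 2.
  have wa : w z / a < phi z by rewrite ltr_pdivrMr // mulrC.
  have n1 : \forall y \near z, b < phi y.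
    by apply: (LSC_near Omega) => //; [exact: TO|rewrite /b; lra].
  have n2 : \forall y \near z, w y < a * b.
    have wab : w z < a * b by rewrite mulrC -ltr_pdivrMr // /b; lra.
    exact: (tube_test_continuous x e k d 1 z _ (lt_nbhsl wab)).
  apply: filterS2 n1 n2 => u u1 u2 Tu; rewrite ltr_pdivrMr ?phi0 //; last exact: TO.
  by apply: lt_trans u2 _; rewrite ltr_pM2l.
have pz := phi0 _ (TO _ Tz).
pose m := w z / phi z; have m0 : 0 < m.
  by apply: lt_le_trans (zmax _ Tz1); rewrite divr_gt0 // phi0 //; exact: TO.
have wz : 0 < w z by move: m0; rewrite /m pmulr_lgt0 // invr_gt0.
pose psi := tube_test x e k d m^-1.
have psiE u : psi u = m^-1 * w u by rewrite /psi /w /tube_test mul1r.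
have [C2 He] := tube_test_C2 x e k d m^-1 e1 z.
have psiz : phi z = psi z.
  by rewrite psiE /m invf_div divfK // lt0r_neq0.
have inT : \forall u \near z, tube x e l d u.
  have [z0 zl zP] := Tz.
  have sP : 0 < sin (k * dot (z - x) e) * tube_profile x e d z.
    by move: wz; rewrite /w /tube_test mul1r.
  have P0 : 0 < tube_profile x e d z.
    rewrite lt_def zP andbT; apply/eqP => P0; by rewrite P0 mulr0 ltxx in sP.
  have t0 : 0 < dot (z - x) e.
    rewrite lt_def z0 andbT; apply/eqP => t0.
    by rewrite t0 mulr0 sin0 mul0r ltxx in sP.
  have tl : dot (z - x) e < l.
    rewrite lt_def zl andbT; apply/eqP => t1.
    by rewrite -t1 /k divfK ?lt0r_neq0 // sinpi mul0r ltxx in sP.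
  have n1 : \forall u \near z, 0 < dot (u - x) e.
    exact: (tube_coord_continuous x e z _ (lt_nbhsr t0)).
  have n2 : \forall u \near z, dot (u - x) e < l.
    exact: (tube_coord_continuous x e z _ (lt_nbhsl tl)).
  have n3 : \forall u \near z, 0 < tube_profile x e d u.
    exact: (tube_profile_continuous x e d z _ (lt_nbhsr P0)).
  by apply: filterS3 n1 n2 n3 => u u1 u2 u3; split; exact: ltW.
have := vphi z psi (TO _ Tz) C2.
have near_min : \forall u \near z, Omega u -> phi z - psi z <= phi u - psi u.
  apply: filterS inT => u Tu Ou; rewrite psiz subrr subr_ge0 psiE.
  by rewrite ler_pdivrMl // -ler_pdivrMr ?phi0 // zmax.
move=> /(_ near_min psiz) muz.
have := qform_le_lambda_max (hessian psi z) e N0 (C2_hessian_sym psi z C2).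
rewrite e1 mulr1 He -/psi -psiz => lam.
by rewrite -(ler_pM2r pz); lra.
Qed.

End SegmentBound.

(** * Steiner symmetrization along a coordinate axis *)

Section Steiner.
Context {R : realType} {N : nat}.
Implicit Types (A : set 'rV[R]_N) (c x y z : 'rV[R]_N) (i j : 'I_N) (s t r : R).

Definition upd x i t : 'rV[R]_N := \row_j (if j == i then t else x 0 j).

Definition diam_le A r := forall x y, A x -> A y -> dot (x - y) (x - y) <= r ^+ 2.

(** Solidity in all coordinates makes [A] symmetric with respect to [c], and makes
    the complement of [A] contain a box next to each of its points. *)
Definition solid c i A :=
  forall x t, A x -> `|t - c 0 i| <= `|x 0 i - c 0 i| -> A (upd x i t).

(** For open convex [A] the sections parallel to the axis [i] are open intervals,
    and each is replaced by the interval of the same length centred at [c].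
    Comparing with pairs of points of a section, rather than with its length,
    makes openness, convexity and the diameter bound elementary. *)
Definition steiner c i A : set 'rV[R]_N :=
  [set x | exists t1 t2, [/\ A (upd x i t1), A (upd x i t2) &
     2 * `|x 0 i - c 0 i| < t2 - t1]].

(** The squared distance between the projections along the axis [i]. *)
Definition off_sq i x y : R := \sum_(j | j != i) (x 0 j - y 0 j) ^+ 2.

Lemma upd_eq x i t : upd x i t 0 i = t.
Proof. by rewrite mxE eqxx. Qed.

Lemma upd_neq x i j t : j != i -> upd x i t 0 j = x 0 j.
Proof. by rewrite mxE => /negPf ->. Qed.

Lemma upd_id x i : upd x i (x 0 i) = x.
Proof. by apply/rowP => j; rewrite mxE; case: eqP => [->|]. Qed.

Lemma updK x i s t : upd (upd x i s) i t = upd x i t.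
Proof. by apply/rowP => j; rewrite !mxE; case: eqP. Qed.

Lemma updC x i j s t : i != j -> upd (upd x i s) j t = upd (upd x j t) i s.
Proof.
move=> ij; apply/rowP => k; rewrite !mxE.
by case: (eqVneq k j) => [->|//]; rewrite eq_sym (negPf ij).
Qed.

Lemma dot_sub_off i x y :
  dot (x - y) (x - y) = off_sq i x y + (x 0 i - y 0 i) ^+ 2.
Proof.
rewrite /dot /off_sq (bigD1 i) //= !mxE addrC -expr2; congr (_ + _).
by apply: eq_bigr => j _; rewrite !mxE -expr2.
Qed.

Lemma off_sq_upd i x y s t : off_sq i (upd x i s) (upd y i t) = off_sq i x y.
Proof. by apply: eq_bigr => j ji; rewrite !upd_neq. Qed.

Lemma dot_sub_upd i x y s t :
  dot (upd x i s - upd y i t) (upd x i s - upd y i t) = off_sq i x y + (s - t) ^+ 2.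
Proof. by rewrite (dot_sub_off i) off_sq_upd !upd_eq. Qed.

Lemma off_sq_ge0 i x y : 0 <= off_sq i x y.
Proof. by apply: sumr_ge0 => j _; exact: sqr_ge0. Qed.

Lemma near_coord x j t1 t2 : t1 < x 0 j < t2 ->
  \forall y \near x, t1 < (y : 'rV[R]_N) 0 j < t2.
Proof.
move=> /andP[h1 h2].
have n1 : \forall y \near x, t1 < (y : 'rV[R]_N) 0 j.
  exact: (@coord_continuous _ _ _ 0 j x _ (lt_nbhsr h1)).
have n2 : \forall y \near x, (y : 'rV[R]_N) 0 j < t2.
  exact: (@coord_continuous _ _ _ 0 j x _ (lt_nbhsl h2)).
by apply: filterS2 n1 n2 => y -> ->.
Qed.

Lemma upd_continuous i t : continuous (fun x => upd x i t).
Proof.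
move=> x P /nbhs_ballP[e /= e0 eP]; apply/nbhs_ballP; exists e => // y [_ xy].
apply: eP; split => // k j; rewrite !mxE; case: eqP => _; first exact: ballxx.
by have := xy k j; rewrite (ord1 k).
Qed.

Lemma upd_continuous2 x i : continuous (fun t => upd x i t).
Proof.
move=> t P /nbhs_ballP[e /= e0 eP]; apply/nbhs_ballP; exists e => // s ts.
by apply: eP; split => // k j; rewrite !mxE; case: eqP => _ //; exact: ballxx.
Qed.

Lemma open_upd_near A i x t : open A -> A (upd x i t) ->
  \forall y \near x, A (upd y i t).
Proof. by move=> oA Ax; apply: upd_continuous; exact: open_nbhs_nbhs. Qed.

Lemma open_upd_near2 A i x t : open A -> A (upd x i t) ->
  \forall s \near t, A (upd x i s).
Proof. by move=> oA Ax; apply: upd_continuous2; exact: open_nbhs_nbhs. Qed.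

Lemma steiner_open c i A : open A -> open (steiner c i A).
Proof.
move=> oA; rewrite openE => x [t1 [t2 [A1 A2 lt]]].
have lt' : c 0 i - (t2 - t1) / 2 < x 0 i < c 0 i + (t2 - t1) / 2.
  rewrite -ltr_distl; lra.
apply: filterS3 (open_upd_near A i x t1 oA A1) (open_upd_near A i x t2 oA A2)
  (near_coord _ _ _ _ lt') => y B1 B2.
rewrite -ltr_distl => yb; exists t1, t2; split => //; lra.
Qed.

Lemma upd_comb x y i s t a :
  a *: upd x i s + (1 - a) *: upd y i t =
  upd (a *: x + (1 - a) *: y) i (a * s + (1 - a) * t).
Proof. by apply/rowP => j; rewrite !mxE; case: eqP. Qed.

Lemma steiner_segment_closed c i A : segment_closed A -> segment_closed (steiner c i A).
Proof.
move=> cA x y a a01 [t1 [t2 [A1 A2 lt]]] [s1 [s2 [B1 B2 ls]]].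
exists (a * t1 + (1 - a) * s1), (a * t2 + (1 - a) * s2); split.
- by rewrite -upd_comb; exact: cA.
- by rewrite -upd_comb; exact: cA.
- rewrite !mxE; move: a01 => /andP[a0 a1].
  set u := x 0 i in lt *; set v := y 0 i in ls *; set k := c 0 i in lt ls *.
  have -> : a * u + (1 - a) * v - k = a * (u - k) + (1 - a) * (v - k) by ring.
  have h : `|a * (u - k) + (1 - a) * (v - k)| <= a * `|u - k| + (1 - a) * `|v - k|.
    apply: le_trans (ler_normD _ _) _; rewrite !normrM (ger0_norm a0).
    by rewrite (ger0_norm (_ : 0 <= 1 - a)) // subr_ge0.
  have [a00|a00] := eqVneq a 0; first by rewrite a00 in h *; lra.
  have a0' : 0 < a by rewrite lt_def a00.
  have : a * (2 * `|u - k|) < a * (t2 - t1) by rewrite ltr_pM2l.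
  have : (1 - a) * (2 * `|v - k|) <= (1 - a) * (s2 - s1).
    by rewrite ler_wpM2l ?subr_ge0 // ltW.
  lra.
Qed.

(** Of the two pairs of opposite ends of the sections over [x] and [y], one is
    at least as far apart as any two points of the symmetrized sections. *)
Lemma steiner_diam c i A r : diam_le A r -> diam_le (steiner c i A) r.
Proof.
move=> dA x y [t1 [t2 [A1 A2 lt]]] [s1 [s2 [B1 B2 ls]]].
rewrite (dot_sub_off i).
have := dA _ _ A2 B1; have := dA _ _ A1 B2; rewrite !dot_sub_upd.
set o := off_sq i x y.
have d : `|x 0 i - y 0 i| <= `|x 0 i - c 0 i| + `|y 0 i - c 0 i|.
  have -> : x 0 i - y 0 i = (x 0 i - c 0 i) - (y 0 i - c 0 i) by ring.
  exact: ler_normB.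
have d0 : 0 <= `|x 0 i - y 0 i| by [].
have -> : (x 0 i - y 0 i) ^+ 2 = `|x 0 i - y 0 i| ^+ 2 by rewrite real_normK // num_real.
set p := `|x 0 i - y 0 i| in d d0 *.
have [h h2 _|h _ h2] : (p <= s2 - t1) \/ (p <= t2 - s1).
  have [|h] := leP p (s2 - t1); [by left|right; lra].
- apply: le_trans h2; rewrite lerD2l -[leRHS]sqrrN opprB.
  by rewrite ler_sqr ?nnegrE //; lra.
- apply: le_trans h2; rewrite lerD2l.
  by rewrite ler_sqr ?nnegrE //; lra.
Qed.

Lemma steiner_solid c i A : solid c i (steiner c i A).
Proof.
move=> x t [t1 [t2 [A1 A2 lt]]] tx; exists t1, t2; rewrite !updK upd_eq.
by split => //; apply: le_lt_trans lt; rewrite ler_pM2l.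
Qed.

Lemma steiner_solid_other c i j A : solid c j A -> solid c j (steiner c i A).
Proof.
have [->|ij] := eqVneq i j; first by move=> _; exact: steiner_solid.
move=> sA x t [t1 [t2 [A1 A2 lt]]] tx; exists t1, t2; split.
- rewrite updC 1?eq_sym //; apply: sA => //; by rewrite upd_neq // eq_sym.
- rewrite updC 1?eq_sym //; apply: sA => //; by rewrite upd_neq // eq_sym.
- by rewrite upd_neq.
Qed.

(** Moves the coordinates one at a time. *)
Lemma solid_all c A x y : (forall j, solid c j A) -> A x ->
  (forall j, `|y 0 j - c 0 j| <= `|x 0 j - c 0 j|) -> A y.
Proof.
move=> sA Ax yx.
(* the points between [x] and [y] with the coordinates in [s] already moved *)
pose m (s : seq 'I_N) : 'rV[R]_N := \row_j (if j \in s then y 0 j else x 0 j).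
suff Am (l : seq 'I_N) : A (m l).
  rewrite (_ : y = m (enum 'I_N)) //; apply/rowP => j; by rewrite mxE mem_enum.
elim: l => [|i s IH].
  by rewrite (_ : m _ = x) //; apply/rowP => j; rewrite mxE.
have -> : m (i :: s) = upd (m s) i (y 0 i).
  by apply/rowP => j; rewrite !mxE inE; case: eqP => [->|].
have [is_|is_] := boolP (i \in s).
  rewrite (_ : upd _ _ _ = m s) //; apply/rowP => j; rewrite !mxE.
  by case: eqP => [->|//]; rewrite is_.
by apply: sA => //; rewrite mxE (negPf is_).
Qed.

End Steiner.

(** * Domains of diameter [2r] whose Steiner symmetrization is a ball *)

(** Cutting the unit interval into [n] equal parts bounds the total variation of
    [f] by [n] times [K / n^2]. *)
Lemma quadratic_modulus_const {R : realType} (f : R -> R) (K : R) :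
  (forall s t, 0 <= s <= 1 -> 0 <= t <= 1 -> f s - f t <= K * (s - t) ^+ 2) ->
  f 1 = f 0.
Proof.
move=> fK; have K0 : 0 <= K.
  have : f 1 - f 0 + (f 0 - f 1) <= K * (1 - 0) ^+ 2 + K * (0 - 1) ^+ 2.
    by apply: lerD; apply: fK; rewrite ?lexx ?ler01.
  lra.
have step (n : nat) : `|f 1 - f 0| <= K / n.+1%:R.
  have n0 : (0 : R) < n.+1%:R by rewrite ltr0n.
  pose x (k : nat) : R := k%:R / n.+1%:R.
  have x01 k : (k <= n.+1)%N -> 0 <= x k <= 1.
    by move=> kn; rewrite divr_ge0 ?ler0n //= ler_pdivrMr // mul1r ler_nat.
  have dx k : x k.+1 - x k = n.+1%:R^-1.
    by rewrite /x -mulrBl -addn1 natrD addrAC subrr add0r mul1r.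
  suff H k : (k <= n.+1)%N -> `|f (x k) - f (x 0%N)| <= k%:R * (K * n.+1%:R ^- 2).
    have := H n.+1 (leqnn _); rewrite /x divff ?lt0r_neq0 // mul0r.
    have -> : n.+1%:R * (K * n.+1%:R ^- 2) = K / n.+1%:R; last by [].
    by field; exact: lt0r_neq0.
  elim: k => [_|k IH kn]; first by rewrite subrr normr0 mul0r.
  rewrite -natr1 mulrDl mul1r.
  have -> : f (x k.+1) - f (x 0%N) =
      (f (x k) - f (x 0%N)) + (f (x k.+1) - f (x k)) by ring.
  apply: le_trans (ler_normD _ _) _; apply: lerD; first exact: IH (ltnW kn).
  rewrite ler_norml lerNl opprB -[n.+1%:R ^- 2]exprVn.
  apply/andP; split.
    apply: le_trans (fK _ _ (x01 _ (ltnW kn)) (x01 _ kn)) _.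
    by rewrite -[x k - _]opprB sqrrN dx.
  by apply: le_trans (fK _ _ (x01 _ kn) (x01 _ (ltnW kn))) _; rewrite dx.
apply/eqP; rewrite -subr_eq0 -normr_le0; apply/ler_addgt0Pr => e e0; rewrite add0r.
have [n ne] : exists n : nat, K / e < n%:R.
  exists (Num.bound (K / e)); apply: le_lt_trans (archi_boundP _) => //.
  by rewrite ?divr_ge0 // ltW.
apply: le_trans (step n) _; rewrite ler_pdivrMr ?ltr0n // mulrC -ler_pdivrMr //.
by rewrite -natr1; lra.
Qed.

(** A rigidity estimate in a plane: if the midpoints [f] of the sections of
    half-lengths [g t = sqrt (r^2 - t^2 q)] respect the diameter bound, they vary
    by [O (|s - t|^2)], because the points [(s, g s)] and [(t, g t)] lie on a
    circle and are at distance [O (|s - t|)]. *)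
Lemma midpoints_const {R : realType} (f : R -> R) (r q : R) : 0 <= q < r ^+ 2 ->
  let g t := Num.sqrt (r ^+ 2 - t ^+ 2 * q) in
  (forall s t, 0 <= s <= 1 -> 0 <= t <= 1 ->
     f s - f t + (g s + g t) <= Num.sqrt (4 * r ^+ 2 - (s + t) ^+ 2 * q)) ->
  f 1 = f 0.
Proof.
move=> /andP[q0 qr] g fg; pose m := Num.sqrt (r ^+ 2 - q).
have m0 : 0 < m by rewrite sqrtr_gt0 subr_gt0.
have sq1 (t : R) : 0 <= t <= 1 -> t ^+ 2 <= 1.
  by move=> /andP[t0 t1]; rewrite expr_le1.
have gm t : 0 <= t <= 1 -> m <= g t.
  move=> /sq1 t1; rewrite ler_wsqrtr // lerD2l lerN2.
  by rewrite -[leRHS]mul1r ler_wpM2r.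
have g2 t : 0 <= t <= 1 -> g t ^+ 2 = r ^+ 2 - t ^+ 2 * q.
  move=> /sq1 t1; rewrite sqr_sqrtr // subr_ge0 (le_trans _ (ltW qr)) //.
  by rewrite -[leRHS]mul1r ler_wpM2r.
apply: (quadratic_modulus_const f ((q ^+ 2 / m ^+ 2 + q) / (4 * m))) => s t s01 t01.
have gs := gm _ s01; have gt := gm _ t01; have gs2 := g2 _ s01; have gt2 := g2 _ t01.
have := fg _ _ s01 t01; set D := f s - f t.
set x := g s in gs gs2 *; set y := g t in gt gt2 *.
move=> H.
have C0 : 0 <= (q ^+ 2 / m ^+ 2 + q) / (4 * m).
  by rewrite divr_ge0 ?mulr_ge0 ?(ltW m0) // addr_ge0 // divr_ge0 ?sqr_ge0.
have [D0|D0] := leP D 0.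
  by apply: le_trans D0 _; rewrite mulr_ge0 // sqr_ge0.
have xy0 : 0 < x + y by lra.
have gap : (x - y) ^+ 2 <= q ^+ 2 / m ^+ 2 * (s - t) ^+ 2.
  have E : (x - y) * (x + y) = (t - s) * ((t + s) * q).
    have -> : (x - y) * (x + y) = x ^+ 2 - y ^+ 2 by ring.
    by rewrite gs2 gt2; ring.
  have -> : q ^+ 2 / m ^+ 2 * (s - t) ^+ 2 = (q * (s - t)) ^+ 2 / m ^+ 2.
    by field; exact: lt0r_neq0.
  rewrite ler_pdivlMr ?exprn_gt0 // -exprMn -[leLHS]real_normK ?num_real //.
  rewrite -[leRHS]real_normK ?num_real // ler_sqr ?nnegrE //.
  have h1 : `|x - y| * (2 * m) <= `|(x - y) * (x + y)|.
    by rewrite normrM ler_wpM2l // ger0_norm; lra.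
  have h2 : `|(x - y) * (x + y)| <= `|q * (s - t)| * 2.
    rewrite E mulrA (mulrC _ q) mulrA normrM -[t - s]opprB mulrN normrN.
    by rewrite ler_wpM2l // ger0_norm; lra.
  by rewrite normrM (gtr0_norm m0); lra.
have H2 : (D + (x + y)) ^+ 2 <= 4 * r ^+ 2 - (s + t) ^+ 2 * q.
  have p0 : 0 <= 4 * r ^+ 2 - (s + t) ^+ 2 * q.
    rewrite leNgt; apply/negP => neg; move: H; rewrite ltr0_sqrtr //; lra.
  rewrite -[leRHS](sqr_sqrtr p0) ler_sqr ?nnegrE ?sqrtr_ge0 //; lra.
have H3 : 4 * r ^+ 2 - (s + t) ^+ 2 * q - (x + y) ^+ 2 = (x - y) ^+ 2 + (s - t) ^+ 2 * q.
  have -> : (x - y) ^+ 2 = 2 * x ^+ 2 + 2 * y ^+ 2 - (x + y) ^+ 2 by ring.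
  by rewrite gs2 gt2; ring.
rewrite mulrAC ler_pdivlMr ?mulr_gt0 //.
have H4 : D * (4 * m) <= D * (2 * (x + y)) by rewrite ler_pM2l //; lra.
apply: le_trans H4 _.
have -> : D * (2 * (x + y)) = (D + (x + y)) ^+ 2 - D ^+ 2 - (x + y) ^+ 2 by ring.
have := sqr_ge0 D.
have -> : (q ^+ 2 / m ^+ 2 + q) * (s - t) ^+ 2 =
    q ^+ 2 / m ^+ 2 * (s - t) ^+ 2 + (s - t) ^+ 2 * q by ring.
lra.
Qed.

Section SteinerBall.
Context {R : realType} {N : nat}.
Variables (c z : 'rV[R]_N) (i : 'I_N) (A : set 'rV[R]_N) (r : R).
Hypotheses (r0 : 0 < r) (oA : open A) (cA : segment_closed A).
Hypotheses (dA : diam_le A (2 * r)) (sA : steiner c i A = eball z r).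
Hypothesis zi : z 0 i = c 0 i.
Implicit Types x y w : 'rV[R]_N.

Let fiber y : set R := [set t | A (upd y i t)].

(** [y] projects into the projection of the ball; there [half y] is half the
    length of the section of the ball. *)
Let base y := off_sq i y z < r ^+ 2.

Let half y : R := Num.sqrt (r ^+ 2 - off_sq i y z).

Let lo y := inf (fiber y).

Let hi y := sup (fiber y).

Let half_gt0 y : base y -> 0 < half y.
Proof. by move=> yb; rewrite sqrtr_gt0 subr_gt0. Qed.

Let half_sq y : base y -> half y ^+ 2 = r ^+ 2 - off_sq i y z.
Proof. by move=> yb; rewrite sqr_sqrtr // subr_ge0 ltW. Qed.

Let in_ball x : eball z r x <-> off_sq i x z + (x 0 i - z 0 i) ^+ 2 < r ^+ 2.
Proof. by rewrite /eball /= enorm_lt // (dot_sub_off i). Qed.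

Let chord y (t : R) : base y -> `|t| < half y ->
  exists t1 t2 : R, [/\ fiber y t1, fiber y t2 & 2 * `|t| < t2 - t1].
Proof.
move=> yb th; have : eball z r (upd y i (c 0 i + t)).
  apply/in_ball; rewrite upd_eq zi addrAC subrr add0r.
  rewrite (_ : off_sq _ _ _ = off_sq i y z); last first.
    by apply: eq_bigr => j ji; rewrite upd_neq.
  have : t ^+ 2 < half y ^+ 2.
    rewrite -[t ^+ 2]real_normK ?num_real // ltr_sqr ?nnegrE //.
    exact: ltW (half_gt0 _ yb).
  by rewrite half_sq //; lra.
rewrite -sA => -[t1 [t2 [A1 A2 lt]]]; exists t1, t2.
by move: A1 A2 lt; rewrite !updK upd_eq addrAC subrr add0r.
Qed.

Let fiber_ex y : base y -> exists t, fiber y t.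
Proof.
move=> yb; have [|t1 [t2 [h _ _]]] := chord y 0 yb; first by rewrite normr0 half_gt0.
by exists t1.
Qed.

Let fiber_dist y w (s t : R) : fiber y s -> fiber w t ->
  off_sq i y w + (s - t) ^+ 2 <= 4 * r ^+ 2.
Proof.
move=> ys wt; have := dA _ _ ys wt; rewrite dot_sub_upd.
by rewrite exprMn (_ : 2 ^+ 2 = 4 :> R) //; ring.
Qed.

Let fiber_gap y w (s t : R) : fiber y s -> fiber w t ->
  s - t <= Num.sqrt (4 * r ^+ 2 - off_sq i y w).
Proof.
move=> ys wt; have := fiber_dist _ _ _ _ ys wt => h.
have [st|st] := leP (s - t) 0; first by apply: le_trans st _; rewrite sqrtr_ge0.
have <- : Num.sqrt ((s - t) ^+ 2) = s - t by rewrite sqrtr_sqr ger0_norm // ltW.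
rewrite ler_wsqrtr //; lra.
Qed.

Let fiber_sup y : base y -> has_sup (fiber y).
Proof.
move=> yb; have [t yt] := fiber_ex y yb; split; first by exists t.
exists (t + Num.sqrt (4 * r ^+ 2 - off_sq i y y)) => s ys.
by rewrite -lerBlDl; exact: fiber_gap.
Qed.

Let fiber_inf y : base y -> has_inf (fiber y).
Proof.
move=> yb; have [t yt] := fiber_ex y yb; split; first by exists t.
exists (t - Num.sqrt (4 * r ^+ 2 - off_sq i y y)) => s ys.
by rewrite lerBlDr -lerBlDl; exact: fiber_gap.
Qed.

Let hi_lo_gap y w : base y -> base w ->
  hi y - lo w <= Num.sqrt (4 * r ^+ 2 - off_sq i y w).
Proof.
move=> yb wb; rewrite lerBlDr -lerBlDl; apply: lb_le_inf; first exact: (fiber_inf w wb).1.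
move=> t wt; rewrite lerBlDr -lerBlDl lerBlDl.
apply: ge_sup; first exact: (fiber_sup y yb).1.
by move=> s ys; rewrite -lerBlDl; exact: fiber_gap.
Qed.

Let len_ge y : base y -> 2 * half y <= hi y - lo y.
Proof.
move=> yb; rewrite leNgt; apply/negP => lt.
have lt0 : 0 <= hi y - lo y.
  rewrite subr_ge0; have [t yt] := fiber_ex y yb; apply: (@le_trans _ _ t).
    by apply: ge_inf => //; exact: (fiber_inf y yb).2.
  by apply: ub_le_sup => //; exact: (fiber_sup y yb).2.
have [|t1 [t2 [y1 y2]]] := chord y ((hi y - lo y) / 2) yb.
  by rewrite ger0_norm; lra.
have h1 : lo y <= t1 by apply: ge_inf => //; exact: (fiber_inf y yb).2.
have h2 : t2 <= hi y by apply: ub_le_sup => //; exact: (fiber_sup y yb).2.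
by rewrite ger0_norm; lra.
Qed.

(** Points over [y] and over the opposite point [refl y] are almost diametral:
    the diameter bound forces the two sections to have the same ends. *)
Let refl y : 'rV[R]_N := 2 *: z - y.

Let off_refl y w :
  off_sq i y (refl w) = \sum_(j | j != i) ((y 0 j - z 0 j) + (w 0 j - z 0 j)) ^+ 2.
Proof. by apply: eq_bigr => j _; rewrite !mxE; ring. Qed.

Let base_refl y : base y -> base (refl y) /\ half (refl y) = half y.
Proof.
have E : off_sq i (refl y) z = off_sq i y z.
  by apply: eq_bigr => j _; rewrite !mxE; ring.
by rewrite /base /half E.
Qed.

Let ends_refl y : base y ->
  [/\ hi y - lo y = 2 * half y, hi (refl y) = hi y & lo (refl y) = lo y].
Proof.
move=> yb; have [rb rh] := base_refl y yb.
have h (u : R) : u = 4 * (r ^+ 2 - off_sq i y z) -> Num.sqrt u = 2 * half y.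
  move=> ->; rewrite sqrtrM // (_ : 4 = 2 ^+ 2 :> R); last by ring.
  by rewrite sqrtr_sqr ger0_norm.
have E1 : Num.sqrt (4 * r ^+ 2 - off_sq i y (refl y)) = 2 * half y.
  apply: h; rewrite off_refl mulrBr; congr (_ - _); rewrite /off_sq mulr_sumr.
  by apply: eq_bigr => j _; ring.
have E2 : Num.sqrt (4 * r ^+ 2 - off_sq i (refl y) y) = 2 * half y.
  rewrite -E1; congr (Num.sqrt (_ - _)); apply: eq_bigr => j _.
  by rewrite -sqrrN opprB.
have g1 := hi_lo_gap _ _ yb rb; have g2 := hi_lo_gap _ _ rb yb.
have l1 := len_ge _ yb; have l2 := len_ge _ rb.
rewrite E1 in g1; rewrite E2 in g2; rewrite rh in l2.
by split; lra.
Qed.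

Let mid y := (hi y + lo y) / 2.

Let mid_bound y w : base y -> base w ->
  mid y - mid w + (half y + half w) <= Num.sqrt (4 * r ^+ 2 - off_sq i y (refl w)).
Proof.
move=> yb wb; have [rb _] := base_refl w wb.
have [l1 _ _] := ends_refl y yb; have [l2 _ l3] := ends_refl w wb.
apply: le_trans (hi_lo_gap _ _ yb rb); rewrite l3 /mid; lra.
Qed.

Let mid_const y : base y -> mid y = mid z.
Proof.
move=> yb; pose q := off_sq i y z.
pose p (t : R) := z + t *: (y - z).
have pz t : off_sq i (p t) z = t ^+ 2 * q.
  by rewrite /q /off_sq mulr_sumr; apply: eq_bigr => j _; rewrite !mxE; ring.
have p1 : p 1 = y by rewrite /p scale1r addrC subrK.
have p0 : p 0 = z by rewrite /p scale0r addr0.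
have q0 : 0 <= q by exact: off_sq_ge0.
rewrite -p1 -p0; apply: (midpoints_const (fun t => mid (p t)) r q).
  by rewrite q0.
have bp t : 0 <= t <= 1 -> base (p t).
  move=> /andP[t0 t1]; rewrite /base pz; apply: le_lt_trans yb.
  by rewrite -[leRHS]mul1r ler_wpM2r // expr_le1.
move=> s t s01 t01; have := mid_bound _ _ (bp _ s01) (bp _ t01).
rewrite /half !pz off_refl.
suff -> : \sum_(j | j != i) (p s 0 j - z 0 j + (p t 0 j - z 0 j)) ^+ 2 =
    (s + t) ^+ 2 * q by [].
by rewrite /q /off_sq mulr_sumr; apply: eq_bigr => j _; rewrite !mxE; ring.
Qed.

(** The sections of [A] have the lengths of those of the ball, and their
    midpoints do not depend on the section, so [A] is a ball whose centre is
    displaced along the axis [i]. *)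
Lemma steiner_eq_ball :
  exists2 z' : 'rV[R]_N, (forall j, j != i -> z' 0 j = z 0 j) & A = eball z' r.
Proof.
exists (upd z i (mid z)); first by move=> j ji; rewrite upd_neq.
have inb x : eball (upd z i (mid z)) r x <-> off_sq i x z + (x 0 i - mid z) ^+ 2 < r ^+ 2.
  rewrite /eball /= enorm_lt // (dot_sub_off i) upd_eq.
  rewrite (_ : off_sq i x (upd z i (mid z)) = off_sq i x z) //.
  by apply: eq_bigr => j ji; rewrite upd_neq.
apply/seteqP; split => x.
  move=> Ax; apply/inb.
  have Ax' : A (upd x i (x 0 i)) by rewrite upd_id.
  have /nbhs_ballP[e /= e0 eP] := open_upd_near2 A i x (x 0 i) oA Ax'.
  have A1 : fiber x (x 0 i - e / 2).
    by apply: eP; rewrite /ball /= opprB addrC subrK gtr0_norm; lra.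
  have A2 : fiber x (x 0 i + e / 2).
    by apply: eP; rewrite /ball /= opprD addrA subrr sub0r normrN gtr0_norm; lra.
  have xb : base x.
    have : steiner c i A (upd x i (c 0 i)).
      exists (x 0 i - e / 2), (x 0 i + e / 2); rewrite !updK upd_eq; split => //.
      by rewrite subrr normr0 mulr0; lra.
    rewrite sA => /in_ball; rewrite upd_eq zi subrr expr0n addr0.
    rewrite (_ : off_sq _ _ _ = off_sq i x z) //.
    by apply: eq_bigr => j ji; rewrite upd_neq.
  have [l _ _] := ends_refl x xb.
  have h1 : lo x <= x 0 i - e / 2 by apply: ge_inf => //; exact: (fiber_inf x xb).2.
  have h2 : x 0 i + e / 2 <= hi x by apply: ub_le_sup => //; exact: (fiber_sup x xb).2.
  have : `|x 0 i - mid z| < half x.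
    by rewrite -(mid_const x xb) /mid ltr_norml; apply/andP; split; lra.
  rewrite -ltr_sqr ?nnegrE ?sqrtr_ge0 // half_sq // real_normK ?num_real //; lra.
move=> /inb xb'.
have xb : base x.
  by apply: le_lt_trans xb'; rewrite lerDl sqr_ge0.
have : `|x 0 i - mid z| < half x.
  rewrite -ltr_sqr ?nnegrE ?sqrtr_ge0 // half_sq // real_normK ?num_real //; lra.
have [l _ _] := ends_refl x xb.
rewrite -(mid_const x xb) /mid ltr_norml => /andP[h1 h2].
have x1 : lo x < x 0 i by lra.
have x2 : x 0 i < hi x by lra.
have [t1 A1 t1x] := inf_lt (fiber_inf x xb).1 x1.
have [t2 A2 t2x] := sup_gt (fiber_sup x xb).1 x2.
pose a := (t2 - x 0 i) / (t2 - t1).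
have t12 : 0 < t2 - t1 by lra.
have := cA _ _ a _ A1 A2; rewrite upd_comb.
have -> : a *: x + (1 - a) *: x = x by rewrite -scalerDl addrC subrK scale1r.
have -> : a * t1 + (1 - a) * t2 = x 0 i by rewrite /a; field; exact: lt0r_neq0.
rewrite upd_id; apply; rewrite /a ler_pdivrMr // mul1r.
by apply/andP; split; [rewrite divr_ge0|]; lra.
Qed.

End SteinerBall.

(** * Volumes of symmetrized sets *)

Section ConsRow.
Context {R : realType} {n : nat}.
Implicit Types (t : R) (y : 'rV[R]_n) (x : 'rV[R]_n.+1).

Definition cons_row t y : 'rV[R]_n.+1 := row_mx (const_mx t : 'rV_1) y.

Lemma cons_row0 t y : cons_row t y 0 ord0 = t.
Proof.
have := row_mxEl (const_mx t : 'rV_1) y 0 ord0.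
rewrite [X in _ = X]mxE; apply: etrans.
by congr (cons_row t y _ _); exact: val_inj.
Qed.

Lemma cons_rowS t y j : cons_row t y 0 (lift ord0 j) = y 0 j.
Proof.
rewrite -(row_mxEr (const_mx t : 'rV_1) y 0 j).
by congr (cons_row t y _ _); exact: val_inj.
Qed.

Definition tail_row x : 'rV[R]_n := \row_j x 0 (lift ord0 j).

Lemma tail_rowE x j : tail_row x 0 j = x 0 (lift ord0 j).
Proof. by rewrite mxE. Qed.

Lemma forall_ordS (P : 'I_n.+1 -> Prop) :
  (forall j, P j) <-> P ord0 /\ forall j, P (lift ord0 j).
Proof.
split=> [h|[h0 h] j]; first by split.
by have [k ->|->] := unliftP ord0 j.
Qed.

Lemma upd_cons0 s t y : upd (cons_row s y) ord0 t = cons_row t y.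
Proof.
apply/rowP; apply/forall_ordS; split; first by rewrite upd_eq cons_row0.
by move=> j; rewrite upd_neq // !cons_rowS.
Qed.

Lemma upd_consS s t y j : upd (cons_row s y) (lift ord0 j) t = cons_row s (upd y j t).
Proof.
apply/rowP; apply/forall_ordS; split; first by rewrite upd_neq // !cons_row0.
move=> k; rewrite cons_rowS; have [->|kj] := eqVneq k j; first by rewrite !upd_eq.
by rewrite !upd_neq ?cons_rowS // (inj_eq lift_inj).
Qed.

Lemma cons_row_comb s t y z a :
  a *: cons_row s y + (1 - a) *: cons_row t z =
  cons_row (a * s + (1 - a) * t) (a *: y + (1 - a) *: z).
Proof.
apply/rowP; apply/forall_ordS; split=> [|j].
  rewrite cons_row0 [LHS]mxE; congr (_ + _); rewrite [LHS]mxE.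
    by congr (_ * _); exact: cons_row0.
  by congr (_ * _); exact: cons_row0.
rewrite cons_rowS [LHS]mxE [RHS]mxE; congr (_ + _); rewrite [LHS]mxE [RHS]mxE.
  by congr (_ * _); exact: cons_rowS.
by congr (_ * _); exact: cons_rowS.
Qed.

Lemma cons_row_continuous t : continuous (cons_row t).
Proof.
move=> y P /nbhs_ballP[e /= e0 eP]; apply/nbhs_ballP; exists e => // z [_ yz].
apply: eP; split => // k; rewrite (ord1 k); apply/forall_ordS; split=> [|j].
  by rewrite !cons_row0; exact: ballxx.
by rewrite !cons_rowS.
Qed.

Lemma cons_row_continuousl y : continuous (cons_row^~ y).
Proof.
move=> t P /nbhs_ballP[e /= e0 eP]; apply/nbhs_ballP; exists e => // s ts.
apply: eP; split => // k; rewrite (ord1 k); apply/forall_ordS; split=> [|j].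
  by rewrite !cons_row0.
by rewrite !cons_rowS; exact: ballxx.
Qed.

Lemma dot_sub_cons s t y z :
  dot (cons_row s y - cons_row t z) (cons_row s y - cons_row t z) =
  (s - t) ^+ 2 + dot (y - z) (y - z).
Proof.
rewrite (dot_sub_off ord0) !cons_row0 addrC; congr (_ + _).
rewrite /off_sq big_mkcond big_ord_recl /= add0r; apply: eq_bigr => j _.
by rewrite !cons_rowS !mxE -expr2.
Qed.

End ConsRow.

Definition box {R : realType} {n : nat} (q : 'rV[R]_n) (h : R) : set 'rV[R]_n :=
  [set y | forall j, `|y 0 j - q 0 j| < h].

Section BoxVolume.
Context {R : realType}.

Lemma coord_preimage_cons n (A : set 'rV[R]_n.+1) :
  @lebesgue_coord R n.+1 @^-1` A =
  [set p : R * space_carrier (lebesgue_space R n) |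
     A (cons_row p.1 (lebesgue_coord p.2))].
Proof. by []. Qed.

Lemma box_preimage n (q : 'rV[R]_n.+1) h :
  @lebesgue_coord R n.+1 @^-1` box q h =
  ball (q 0 ord0) h `*` (@lebesgue_coord R n @^-1` box (tail_row q) h).
Proof.
rewrite coord_preimage_cons; apply/seteqP; split => -[t p] /=.
  move=> /forall_ordS[]; rewrite cons_row0 => h0 hS; split.
    by rewrite /ball /= distrC.
  by move=> j; have := hS j; rewrite cons_rowS tail_rowE.
move=> [h0 hS]; apply/forall_ordS; rewrite cons_row0; split.
  by move: h0; rewrite /ball /= distrC.
by move=> j; rewrite cons_rowS -tail_rowE.
Qed.

(** Both statements go by induction on the dimension, a box being the product of
    an interval and a box. *)
Lemma box_volume n (q : 'rV[R]_n) (h : R) : 0 < h ->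
  measurable (@lebesgue_coord R n @^-1` box q h) /\
  volume (box q h) = ((2 * h) ^+ n)%:E.
Proof.
move=> h0; elim: n q => [|n IH] q.
  rewrite /volume (_ : _ @^-1` _ = setT); last first.
    by apply/seteqP; split => // x _ [].
  by split; [exact: measurableT|rewrite /= diracT].
have [mB vB] := IH (tail_row q).
have mb : measurable (ball (q 0 ord0) h : set (measurableTypeR R)).
  exact: measurable_ball.
rewrite /volume box_preimage; split; first exact: (measurableX mb mB).
have := @product_measure1E _ _ _ _ R (space_measure (lebesgue_line R))
  (space_measure (lebesgue_space R n)) (ball (q 0 ord0) h) _ mb mB.
rewrite -/(volume _) vB /= lebesgue_measure_ball ?ltW // -EFinM => E.
by rewrite exprS {1}mulr_natl; exact: E.
Qed.

(** Every open set is a countable union of boxes with rational data. *)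
Lemma open_coord_measurable n (A : set 'rV[R]_n) : open A ->
  measurable (@lebesgue_coord R n @^-1` A).
Proof.
move=> oA.
pose B (u : 'rV[rat]_n * nat) : set 'rV[R]_n := box (map_mx ratr u.1) u.2.+1%:R^-1.
pose F u := if `[< B u `<=` A >] then B u else set0.
have -> : A = \bigcup_u F u.
  apply/seteqP; split => x; last first.
    by move=> [u _]; rewrite /F; case: asboolP => // BA /BA.
  move=> Ax; have /nbhs_ballP[e /= e0 eP] := open_nbhs_nbhs (conj oA Ax).
  have [k ke] : exists k : nat, 2 / e < k%:R.
    exists (Num.bound (2 / e)); apply: le_lt_trans (archi_boundP _) => //.
    by rewrite ?divr_ge0 // ltW.
  pose h : R := k.+1%:R^-1.
  have h0 : 0 < h by rewrite invr_gt0 ltr0n.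
  have he : 2 * h < e.
    rewrite ltr_pdivrMr ?ltr0n // mulrC -ltr_pdivrMr //.
    by apply: lt_trans ke _; rewrite ltr_nat.
  have rat_near j : exists q : rat, `|x 0 j - ratr q| < h.
    have /rat_in_itvoo[q] : x 0 j - h < x 0 j + h by lra.
    rewrite in_itv /= => /andP[q1 q2]; exists q.
    by rewrite ltr_norml; apply/andP; split; lra.
  have [q qP] := choice rat_near.
  pose u : 'rV[rat]_n * nat := (\row_j q j, k).
  have Bx : B u x by move=> j; rewrite !mxE; exact: qP.
  have BA : B u `<=` A.
    move=> y By; apply: eP; split => // i j; rewrite (ord1 i) /ball /=.
    have := Bx j; have := By j; rewrite !mxE /= -/h => y1 x1.
    rewrite (_ : _ - _ = (x 0 j - ratr (q j)) - (y 0 j - ratr (q j))); last by ring.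
    by apply: le_lt_trans (ler_normB _ _) _; lra.
  by exists u => //; rewrite /F; case: asboolP.
rewrite preimage_bigcup; apply: countable_bigcupT_measurable => [|u].
  exact: countableP.
rewrite /F; case: asboolP => _; last by rewrite preimage_set0; exact: measurable0.
by apply: (box_volume _ _ _ _).1; rewrite invr_gt0 ltr0n.
Qed.

End BoxVolume.

Lemma comb_id {R : realType} {n : nat} (y : 'rV[R]_n) (a : R) :
  a *: y + (1 - a) *: y = y.
Proof. by rewrite -scalerDl addrC subrK scale1r. Qed.

Section SteinerVolume.
Context {R : realType}.

(** [I] is an open interval, and so is the set on the left, with the same
    length. *)
Lemma centred_interval_measure (I : set R) (a M : R) : open I ->
  (forall s t x, I s -> I t -> s <= x <= t -> I x) ->
  (forall s t, I s -> I t -> t - s <= M) ->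
  lebesgue_measure [set t | exists t1 t2, [/\ I t1, I t2 & 2 * `|t - a| < t2 - t1]] =
  lebesgue_measure I.
Proof.
move=> oI cI bI; have [->|/set0P[x0 Ix0]] := eqVneq I set0.
  rewrite (_ : [set t | _] = set0) //; apply/seteqP; split=> // t /=.
  by move=> [? [? []]].
have hs : has_sup I.
  by split; [exists x0 | exists (x0 + M) => t It; rewrite -lerBlDl bI].
have hi : has_inf I.
  by split; [exists x0 | exists (x0 - M) => t It; rewrite lerBlDr -lerBlDl bI].
have room x : I x -> exists2 e, 0 < e & I (x - e) /\ I (x + e).
  move=> Ix; have /nbhs_ballP[e /= e0 eP] := open_nbhs_nbhs (conj oI Ix).
  exists (e / 2); first by rewrite divr_gt0.
  split; apply: eP; rewrite /ball /=.
    by rewrite opprB addrC subrK gtr0_norm; lra.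
  by rewrite opprD addrA subrr sub0r normrN gtr0_norm; lra.
have lo t : I t -> inf I <= t by move=> It; apply: ge_inf => //; exact: hi.2.
have up t : I t -> t <= sup I by move=> It; apply: ub_le_sup => //; exact: hs.2.
have IE : I = [set` `]inf I, sup I[ ].
  apply/seteqP; split=> x /=; rewrite in_itv /=.
    by move=> /room[e e0 [/lo h1 /up h2]]; lra.
  move=> /andP[h1 h2]; have [s Is sx] := inf_lt hi.1 h1; have [t It tx] := sup_gt hs.1 h2.
  by apply: (cI s t) => //; rewrite !ltW.
have lt : inf I < sup I.
  by have [e e0 [/lo h1 /up h2]] := room _ Ix0; lra.
pose d := (sup I - inf I) / 2.
have -> : [set t | exists t1 t2, [/\ I t1, I t2 & 2 * `|t - a| < t2 - t1]] =
    [set` `]a - d, a + d[ ].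
  apply/seteqP; split=> t /=; rewrite in_itv /=.
    move=> [t1 [t2 [/lo h1 /up h2 h]]]; rewrite -ltr_distl /d; lra.
  rewrite -ltr_distl => h; pose e := d - `|t - a|.
  have h1 : inf I < inf I + e by rewrite /e; lra.
  have h2 : sup I - e < sup I by rewrite /e; lra.
  have [s Is sx] := inf_lt hi.1 h1; have [u Iu ux] := sup_gt hs.1 h2.
  by exists s, u; split => //; move: sx ux; rewrite /e /d; lra.
rewrite [in RHS]IE !lebesgue_measure_itv /= !lte_fin lt.
have -> : a - d < a + d by rewrite /d; lra.
by rewrite -!EFinB; congr EFin; rewrite /d; lra.
Qed.

Section Fubini.
Context {n : nat}.
Local Notation T := (space_carrier (lebesgue_space R n)).
Local Notation mu := (space_measure (lebesgue_space R n)).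

Lemma volume_slices (X : set 'rV[R]_n.+1) :
  volume X = (\int[lebesgue_measure]_(t in (setT : set R))
    volume [set y | X (cons_row t y)])%E.
Proof.
rewrite /volume; apply: eq_integral => t _ /=; congr (space_measure _ _).
by apply/seteqP; split => p /=; [move/xsectionP|move=> h; apply/xsectionP].
Qed.

Lemma volume_fibers (X : set 'rV[R]_n.+1) : open X ->
  volume X = (\int[mu]_(p in (setT : set T))
    lebesgue_measure [set t | X (cons_row t (lebesgue_coord p))])%E.
Proof.
move=> oX; have mX := open_coord_measurable _ X oX.
have := @product_measure_unique _ _ _ _ R (space_measure (lebesgue_line R)) mu
  (product_measure2 (space_measure (lebesgue_line R)) mu)
  (fun A B => @product_measure2E _ _ _ _ R (space_measure (lebesgue_line R)) mu A B)
  _ mX.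
rewrite /volume => E; apply: etrans E _.
apply: eq_integral => p _ /=; congr (lebesgue_measure _).
by apply/seteqP; split => t /=; [move/ysectionP|move=> h; apply/ysectionP].
Qed.

End Fubini.

Lemma open_slice n (A : set 'rV[R]_n.+1) t : open A -> open [set y | A (cons_row t y)].
Proof. by move=> oA; apply: open_comp => // y _; exact: cons_row_continuous. Qed.

Lemma open_fiber n (A : set 'rV[R]_n.+1) y : open A -> open [set t | A (cons_row t y)].
Proof. by move=> oA; apply: open_comp => // t _; exact: cons_row_continuousl. Qed.

(** By induction on the dimension. Slices at a fixed first coordinate reduce the
    symmetrization along another coordinate to a smaller dimension; for the first
    coordinate itself the volume is computed by integrating the lengths of the
    sections. *)
Lemma volume_steiner n (c : 'rV[R]_n) i A r :
  open A -> segment_closed A -> diam_le A r -> volume (steiner c i A) = volume A.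
Proof.
elim: n c i A => [|n IH] c i A oA cA dA; first by case: i.
have [j ->|->] := unliftP ord0 i.
  rewrite !volume_slices; apply: eq_integral => t _.
  have -> : [set y | steiner c (lift ord0 j) A (cons_row t y)] =
      steiner (tail_row c) j [set y | A (cons_row t y)].
    apply/seteqP; split => y [t1 [t2 [A1 A2 lt]]]; exists t1, t2; move: A1 A2 lt.
      by rewrite !upd_consS cons_rowS tail_rowE.
    by rewrite /= !upd_consS cons_rowS tail_rowE.
  apply: IH; first exact: open_slice.
    move=> y z a a01 Ay Az; have := cA _ _ a a01 Ay Az.
    by rewrite cons_row_comb (_ : a * t + (1 - a) * t = t) //; ring.
  move=> y z Ay Az; have := dA _ _ Ay Az.
  by rewrite dot_sub_cons subrr expr0n add0r.
rewrite (volume_fibers _ (steiner_open c ord0 A oA)) (volume_fibers _ oA).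
apply: eq_integral => p _; set y := lebesgue_coord p.
rewrite -(centred_interval_measure _ (c 0 ord0) `|r| (open_fiber _ A y oA)).
- congr lebesgue_measure; apply/seteqP; split => t [t1 [t2 [A1 A2 lt]]];
    exists t1, t2; move: A1 A2 lt.
    by rewrite !upd_cons0 cons_row0.
  by rewrite /= !upd_cons0 cons_row0.
- move=> s t x /= As At /andP[sx xt].
  have [st|st] := eqVneq s t; first by rewrite (_ : x = s) //; lra.
  have st0 : 0 < t - s by rewrite subr_gt0 lt_def eq_sym st (le_trans sx).
  have := cA _ _ ((t - x) / (t - s)) _ As At.
  rewrite cons_row_comb comb_id.
  have -> : (t - x) / (t - s) * s + (1 - (t - x) / (t - s)) * t = x.
    by field; exact: lt0r_neq0.
  by apply; rewrite divr_ge0 ?ler_pdivrMr ?mul1r; lra.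
- move=> s t /= As At; have := dA _ _ As At.
  rewrite dot_sub_cons subrr (eqP (_ : dot 0 0 == 0 :> R)) ?dot_eq0 // addr0.
  rewrite -[leLHS]real_normK ?num_real // -[leRHS]real_normK ?num_real //.
  rewrite ler_sqr ?nnegrE // distrC; apply: le_trans; exact: ler_norm.
Qed.

End SteinerVolume.

(** * Equality in the isodiametric inequality for convex sets *)

Section Isodiametric.
Context {R : realType} {N : nat}.
Variables (c : 'rV[R]_N) (r : R).
Hypothesis r0 : 0 < r.
Implicit Types (A B : set 'rV[R]_N) (s : seq 'I_N).

Let symm A s := foldl (fun B i => steiner c i B) A s.

Let convex_body A := [/\ open A, segment_closed A & diam_le A (2 * r)].

Let steiner_body i A : convex_body A -> convex_body (steiner c i A).
Proof.
move=> [oA cA dA]; split; first exact: steiner_open.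
  exact: steiner_segment_closed.
exact: steiner_diam.
Qed.

Let symm_body s A : convex_body A ->
  convex_body (symm A s) /\ volume (symm A s) = volume A.
Proof.
elim: s A => [|i s IH] A bA //=.
have [b v] := IH _ (steiner_body i A bA); split => //.
by rewrite v; have [oA cA dA] := bA; exact: volume_steiner oA cA dA.
Qed.

Let symm_solid s A j : solid c j A \/ j \in s -> solid c j (symm A s).
Proof.
elim: s A => [|i s IH] A /=; first by case.
rewrite inE => -[sA|/orP[/eqP <-|js]]; apply: IH.
- by left; exact: steiner_solid_other.
- by left; exact: steiner_solid.
- by right.
Qed.

(** Undoing the symmetrizations one coordinate at a time: after the coordinates
    in [s] only the corresponding coordinates of the centre can have moved. *)
Let symm_eq_ball s A : uniq s -> convex_body A -> symm A s = eball c r ->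
  exists2 z : 'rV[R]_N, (forall j, j \notin s -> z 0 j = c 0 j) & A = eball z r.
Proof.
elim: s A => [|i s IH] A /=; first by move=> _ _ ->; exists c.
move=> /andP[is_ us] bA sE.
have [z zc AE] := IH _ us (steiner_body i A bA) sE.
have [oA cA dA] := bA.
have [z' z'z ->] := steiner_eq_ball c z i A r r0 oA cA dA AE (zc i is_).
exists z' => // j; rewrite inE negb_or => /andP[ji js].
by rewrite z'z // zc.
Qed.

(** The point symmetric to [x] with respect to [c] is in [B] and is at distance
    [2 |x - c|] of [x]; openness excludes [|x - c| = r]. *)
Let solid_sub_ball B : open B -> diam_le B (2 * r) -> (forall j, solid c j B) ->
  B `<=` eball c r.
Proof.
move=> oB dB sB.
have le x : B x -> dot (x - c) (x - c) <= r ^+ 2.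
  move=> Bx; have Bx' : B (2 *: c - x).
    apply: (solid_all c B x _ sB Bx) => j; rewrite !mxE.
    have -> : 2 * c 0 j - x 0 j - c 0 j = c 0 j - x 0 j by ring.
    by rewrite distrC.
  have := dB _ _ Bx Bx'.
  have -> : x - (2 *: c - x) = 2 *: (x - c).
    by apply/rowP => j; rewrite !mxE; ring.
  by rewrite dotZl dotZr; lra.
move=> x Bx; rewrite /eball /= enorm_lt //.
have [d d0 dP] := near_plane B x (x - c) 0 (open_nbhs_nbhs (conj oB Bx)).
have Bh : B (x + (d / 2) *: (x - c)).
  have := dP (d / 2) 0; rewrite scale0r addr0 normr0; apply => //.
  by rewrite gtr0_norm; lra.
have := le _ Bh.
have -> : x + (d / 2) *: (x - c) - c = (1 + d / 2) *: (x - c).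
  by apply/rowP => j; rewrite !mxE; ring.
rewrite dotZl dotZr mulrA -expr2 => h.
have [d1|d1] := ltP (dot (x - c) (x - c)) (r ^+ 2) => //.
have r2 : 0 < r ^+ 2 by rewrite exprn_gt0.
have : (1 + d / 2) ^+ 2 * r ^+ 2 <= r ^+ 2.
  by apply: le_trans h; rewrite ler_wpM2l // sqr_ge0.
rewrite -[leRHS]mul1r ler_pM2r // leNgt => /negP[].
by rewrite exprn_egt1 //; lra.
Qed.

(** A point [p] of the ball outside [B] is the corner of a small box of the ball
    pointing away from [c]. The box misses [B], which then has a smaller
    volume. *)
Let solid_volume_eq B : open B -> B `<=` eball c r -> (forall j, solid c j B) ->
  volume B = volume (eball c r) -> B = eball c r.
Proof.
move=> oB sub sB vE; apply/seteqP; split => // p Ep; apply: contrapT => nBp.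
have /nbhs_ballP[d /= d0 dP] := open_nbhs_nbhs (conj (eball_open N c r) Ep).
pose h := d / 2; have h0 : 0 < h by rewrite divr_gt0.
pose q : 'rV[R]_N := \row_j (p 0 j + if c 0 j <= p 0 j then h else - h).
pose Q := box q h.
have Qp y j : Q y -> `|p 0 j - c 0 j| <= `|y 0 j - c 0 j| /\ `|p 0 j - y 0 j| < d.
  move=> /(_ j); rewrite mxE ltr_norml.
  have [cp|cp] := leP (c 0 j) (p 0 j) => /andP[y1 y2]; split.
  - by rewrite !ger0_norm; lra.
  - by rewrite ltr_norml; apply/andP; rewrite /h in y1 y2; split; lra.
  - by rewrite !ltr0_norm; lra.
  - by rewrite ltr_norml; apply/andP; rewrite /h in y1 y2; split; lra.
have QE : Q `<=` eball c r.
  move=> y Qy; apply: dP; split => // k j; rewrite (ord1 k) /ball /=.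
  by have [] := Qp y j Qy.
have QB : Q `&` B = set0.
  apply/seteqP; split => // y [Qy By]; apply: nBp.
  by apply: (solid_all c B y p sB By) => j; have [] := Qp y j Qy.
have [mQ vQ] := box_volume _ q h h0.
have mB := open_coord_measurable _ _ oB.
have mE := open_coord_measurable _ _ (eball_open N c r).
have [mS vS] := box_volume _ c r r0.
have Efin : (volume (eball c r) < +oo)%E.
  apply: le_lt_trans (ltry ((2 * r) ^+ N)); rewrite -vS.
  apply: le_measure; rewrite ?inE // => x; rewrite /eball /= => xr j.
  apply: le_lt_trans xr; have := coord_le_enorm (lebesgue_coord x - c) j.
  by rewrite !mxE.
have : (volume Q + volume B <= volume (eball c r))%E.
  rewrite /volume -measureU //; last first.
    by rewrite -preimage_setI -/Q QB preimage_set0.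
  apply: le_measure; rewrite ?inE //; first exact: measurableU.
  by move=> x [/QE|/sub].
rewrite vE -[leRHS]add0e leeD2rE; last first.
  by rewrite ge0_fin_numE // measure_ge0.
by rewrite vQ lee_fin leNgt exprn_gt0 // mulr_gt0.
Qed.

(** After symmetrization in all coordinates the set is solid, hence contained in
    the ball, hence equal to it, having the same volume; then the
    symmetrizations are undone. *)
Lemma isodiametric_rigidity A : open A -> segment_closed A ->
  diam_le A (2 * r) -> volume A = volume (eball c r) ->
  exists z, A = eball z r.
Proof.
move=> oA cA dA vA; have bA : convex_body A by [].
have [[oB cB dB] vB] := symm_body (enum 'I_N) A bA.
have sB j : solid c j (symm A (enum 'I_N)).
  by apply: symm_solid; right; rewrite mem_enum.
have BE := solid_volume_eq _ oB (solid_sub_ball _ oB dB sB) sB (etrans vB vA).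
by have [z _ ->] := symm_eq_ball _ _ (enum_uniq _) bA BE; exists z.
Qed.

End Isodiametric.

(** * The Faber-Krahn inequality *)

(** The upper bound comes from diameters of the ball slightly shortened. *)
Lemma mu1_ball {R : realType} {N : nat} (z : 'rV[R]_N) (r : R) : (0 < N)%N ->
  0 < r -> mu1 (eball z r) = ((pi / (2 * r)) ^+ 2)%:E.
Proof.
move=> N0 r0; set k := pi / (2 * r).
have k0 : 0 < k by rewrite divr_gt0 ?pi_gt0 // mulr_gt0.
apply/eqP; rewrite eq_le mu1_ball_ge // andbT leNgt; apply/negP.
move=> /ereal_sup_gt[_ [mu admissible <-]]; rewrite lte_fin => kmu.
have muE : (mu%:E <= mu1 (eball z r))%E by apply: ereal_sup_ubound; exists mu.
pose v := Num.sqrt ((k ^+ 2 + mu) / 2); pose l := pi / v.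
have mean0 : 0 <= (k ^+ 2 + mu) / 2 by have := sqr_ge0 k; lra.
have v2 : v ^+ 2 = (k ^+ 2 + mu) / 2 by rewrite sqr_sqrtr.
have kv : k < v by rewrite -ltr_sqr ?nnegrE ?sqrtr_ge0 ?(ltW k0) // v2; lra.
have v0 : 0 < v by exact: lt_trans kv.
have l0 : 0 < l by rewrite divr_gt0 ?pi_gt0.
have lr : l < 2 * r.
  by move: kv; rewrite /k /l !ltr_pdivrMr ?mulr_gt0 // mulrC.
have lv : pi / l = v by rewrite /l invf_div mulrC divfK // gt_eqF // pi_gt0.
pose e : 'rV[R]_N := delta_mx 0 (Ordinal N0).
have e1 : dot e e = 1 by rewrite dot_delta mxE !eqxx.
have inE (t : R) : t ^+ 2 = (l / 2) ^+ 2 -> eball z r (z + t *: e).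
  move=> tl; rewrite /eball /= addrAC subrr add0r enorm_lt //.
  rewrite dotZl dotZr e1 mulr1 -expr2 tl.
  by rewrite ltr_sqr ?nnegrE; lra.
have dE : z + (l / 2) *: e - (z + (- (l / 2)) *: e) = l *: e.
  by apply/rowP => j; rewrite !mxE; field.
have ne : z + (- (l / 2)) *: e != z + (l / 2) *: e.
  rewrite eq_sym -subr_eq0 dE -dot_eq0 dotZl dotZr e1 mulr1.
  by rewrite mulf_neq0 // gt_eqF.
have := mu1_segment_le (eball z r) _ _ N0 (eball_open N z r)
  (eball_segment_closed z r r0) (inE (- (l / 2)) (sqrrN _)) (inE (l / 2) erefl) ne.
rewrite dE enormE dotZl dotZr e1 mulr1 -expr2 sqrtr_sqr gtr0_norm // lv v2.
move=> /(le_trans muE); rewrite lee_fin; lra.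
Qed.

Theorem theorem1p2 (R : realType) (N : nat) (hN : (0 < N)%N)
    (Omega : set 'rV[R]_N)
    (Omega_open : open Omega)
    (Omega_bounded : bounded_set Omega)
    (Omega_convex : convex_set (Omega : set (convex_lmodType 'rV[R]_N)))
    (c : 'rV[R]_N) (r : R) (r_gt0 : 0 < r)
    (same_volume : volume Omega = volume (eball c r)) :
  (mu1 Omega <= mu1 (eball c r))%E /\
  (mu1 Omega = mu1 (eball c r) <->
   exists z : 'rV[R]_N, Omega = eball z r).
Proof.
have cO := convex_segment_closed Omega Omega_convex.
have ball_of_diam : diam_le Omega (2 * r) -> exists z, Omega = eball z r.
  by move=> dO; exact: isodiametric_rigidity same_volume.
have ball_mu1 (z : 'rV[R]_N) : mu1 (eball z r) = ((pi / (2 * r)) ^+ 2)%:E.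
  exact: mu1_ball z r hN r_gt0.
have [dO|/existsNP[x /existsNP[y /not_implyP[Ox /not_implyP[Oy /negP]]]]] :=
    pselect (diam_le Omega (2 * r)).
  have [z Oz] := ball_of_diam dO.
  by rewrite {1 2}Oz !ball_mu1; split => //; split => // _; exists z.
rewrite -ltNge -enorm_sqr ltr_sqr ?nnegrE ?enorm_ge0 ?mulr_ge0 ?(ltW r_gt0) // => far.
have yx : y != x.
  apply/eqP => yx; move: far; rewrite yx subrr enormE.
  rewrite (eqP (_ : dot 0 0 == 0 :> R)) ?dot_eq0 //.
  by rewrite sqrtr0; lra.
have lt : (mu1 Omega < mu1 (eball c r))%E.
  rewrite ball_mu1.
  apply: le_lt_trans (mu1_segment_le Omega y x hN Omega_open cO Oy Ox yx) _.
  have e0 : 0 < enorm (x - y) by apply: lt_trans far; rewrite mulr_gt0.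
  rewrite lte_fin ltr_sqr ?nnegrE ?divr_ge0 ?pi_ge0 ?(ltW e0) ?mulr_ge0 ?(ltW r_gt0) //.
  by rewrite ltr_pM2l ?pi_gt0 // ltf_pV2 ?posrE // mulr_gt0.
split; first exact: ltW.
split=> [E|[z Oz]]; first by rewrite E ltxx in lt.
by rewrite Oz !ball_mu1 ltxx in lt.
Qed.
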